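(* Let $G$ be a $\lambda$-expander on $n$ vertices with minimum degree $d$ and maximum degree $(1+o(1))d$ such that $\lambda d=\omega(\log^3 n)$ and $d=\omega(\log^3 n\,\log\log n)$. Then $G$ contains a cycle of length $(1-o(1))n$.
   Context: All graphs are finite and simple. A graph $G$ is a $\lambda$-expander if for every $U\subseteq V(G)$ with $|U|\leq |V(G)|/2$ we have $|N_G(U)|\geq\lambda|U|$, where $N_G(U)$ is the external neighborhood of $U$ (the vertices outside $U$ having a neighbor in $U$). Asymptotic notation is with respect to $n\to\infty$: $x=\omega(f(n))$ means $x/f(n)\to\infty$, $o(1)$ denotes a quantity tending to $0$, and $\log^3 n=(\log n)^3$. The conclusion means: for every $\delta>0$ and all sufficiently large $n$ (depending only on $\delta$ and on the rates in the $\omega(\cdot)$ and $o(1)$ hypotheses), $G$ contains a cycle of length at least $(1-\delta)n$. *)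

(* Defs.v *)
From HB Require Import structures.
From mathcomp Require Import all_boot all_order all_algebra.
From mathcomp Require Import all_classical all_reals all_analysis.
Set Implicit Arguments.
Unset Strict Implicit.
Unset Printing Implicit Defensive.
Import Order.TTheory GRing.Theory Num.Theory.
Import numFieldNormedType.Exports.

Local Open Scope ring_scope.

(* Simple graphs are symmetric irreflexive relations on a finType. *)
Definition simple_graph (V : finType) (E : rel V) : Prop :=
  symmetric E /\ irreflexive E.

Definition degree (V : finType) (E : rel V) (v : V) : nat :=
  #|[set w | E v w]|.

(* The default value #|V| exceeds every degree of a simple graph, so it is
   attained only when V is empty. *)
Definition min_degree (V : finType) (E : rel V) : nat :=
  \big[minn/#|V|]_(v : V) degree E v.

Definition max_degree (V : finType) (E : rel V) : nat :=
  \max_(v : V) degree E v.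

Definition ext_nbhd (V : finType) (E : rel V) (U : {set V}) : {set V} :=
  [set w | (w \notin U) && [exists u in U, E u w]].

Definition expander (R : realType) (V : finType) (E : rel V) (lambda : R)
    : Prop :=
  forall U : {set V}, #|U|%:R <= #|V|%:R / 2 :> R ->
    lambda * #|U|%:R <= #|ext_nbhd E U|%:R.

(* A cycle is given by its cyclic sequence of distinct vertices; [ucycle] alone
   also accepts sequences of fewer than three vertices. *)
Definition graph_cycle (V : finType) (E : rel V) (c : seq V) : Prop :=
  ucycle E c /\ (3 <= size c)%N.

(* Main.v *)
Require Import Defs.
From HB Require Import structures.
From mathcomp Require Import all_boot all_order all_algebra.
From mathcomp Require Import zify ring lra.
From mathcomp Require Import boolp reals sequences exp.
Set Implicit Arguments.
Unset Strict Implicit.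
Unset Printing Implicit Defensive.
Import Order.TTheory GRing.Theory Num.Theory.

(** Label the vertices independently and uniformly with [N] labels, where [N] is
    of order [ln n]. All but a small fraction of the labels are layers
    [0, ..., k - 1]; the others are [s + 1] reservoirs, with [s] a large
    multiple of [ln n]. The cycle is found in two steps.

    Paths through the layers. Between consecutive layers the graph is nearly
    regular, so that equal weights on the edges make a nearly perfect fractional
    matching. What a vertex lacks is, apart from layer 0, the difference between
    its degrees into the previous and into the next layer; these have the same
    mean, and a second moment bound ([second_moment]) shows that the total loss
    over all layers is small even compared with a single layer, as soon as [d]
    is much larger than [N ^ 3]. By Hall's theorem with deficiency
    ([layered_hall], [layered_paths]) one matching serves all layers at once;
    following it from layer 0 gives disjoint paths through all the layers which
    cover [(1 - o(1)) n] vertices ([path_forest]).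

    Linking the paths. In each round, the last vertices of the current paths are
    linked in pairs by disjoint paths through a fresh reservoir [R]
    ([linked_terminals]), and a constant fraction of the paths disappears; after
    [s] rounds a single path is left, whose two ends are joined through the last
    reservoir ([link_cycle]). To find the links, consider a family of disjoint
    paths and tripods between terminals which no augmentation improves
    ([blocked_family]). If it is small, then its few ends and centres form a set
    [W] whose removal leaves most terminals in different components. Some union
    [U] of components then contains many terminals and at most half of [R], and
    only [W] separates it from the rest of [R] ([separated_side]).

    Random sets [R] do not allow this. There are too many sets [U] for a union
    bound; but a greedy subset [T] of [U] whose neighbourhood has size of order
    [d * #|T|] and contains most neighbours of every vertex of [U] determines
    [U] well enough: [U] is compared with the hull of [T], which consists of the
    neighbourhood of [T] and of the vertices that have most of their neighbours
    there. Expansion gives a matching with about [lambda * d * #|T|] edges that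
    leave the hull ([cut_matching]). A fixed edge survives in [R] with
    probability [N ^ -2], so if [lambda * d] is much larger than [N ^ 2 * ln n]
    then many of these edges survive, except with probability [n ^ (-4 * #|T|)],
    which pays for the union bound over [T] ([good_labelling]). Every surviving
    edge uses up [W], up to a few exceptional vertices, so [W] cannot be
    small. *)

(** * Hall's theorem with deficiency *)

Section Hall.
Variables (T1 T2 : finType) (h : T1 -> T2 -> bool).

Definition rel_image (S : {set T1}) : {set T2} := [set u | [exists v in S, h v u]].

Lemma rel_imageU (S S' : {set T1}) :
  rel_image (S :|: S') = rel_image S :|: rel_image S'.
Proof.
apply/setP=> u; rewrite !inE; apply/exists_inP/orP.
  by move=> [v]; rewrite inE => /orP[] vS vu; [left|right]; apply/exists_inP; exists v.
by move=> [] /exists_inP[v vS vu]; exists v => //; rewrite inE vS ?orbT.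
Qed.

Lemma mem_rel_image (S : {set T1}) v u : v \in S -> h v u -> u \in rel_image S.
Proof. by move=> vS vu; rewrite inE; apply/exists_inP; exists v. Qed.

(** Either every proper subset has room to spare, and any single edge may be
    fixed first, or some tight subset splits the problem into two smaller ones.
    The target set [B] lets the induction withdraw vertices already used. *)
Lemma hall_restricted (u0 : T2) (A : {set T1}) (B : {set T2}) :
    (forall S : {set T1}, S \subset A -> #|S| <= #|rel_image S :&: B|) ->
  exists sigma : T1 -> T2,
    (forall v, v \in A -> sigma v \in B /\ h v (sigma v)) /\
    {in A &, injective sigma}.
Proof.
move: {2}#|A| (leqnn #|A|) => m; elim: m A B => [|m IH] A B cA hallA.
  have A0 : A = set0 by apply/eqP; rewrite -cards_eq0; lia.
  by exists (fun=> u0); split; [move=> v | move=> v w]; rewrite A0 inE.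
have [->|[a aA]] := set_0Vmem A.
  by exists (fun=> u0); split; [move=> v | move=> v w]; rewrite inE.
case: (pickP [pred S : {set T1} | [&& S \proper A, S != set0 &
    #|rel_image S :&: B| <= #|S|]]) => [S0 /and3P[S0A S0n0 tight]|slack].
  have S0sub := proper_sub S0A.
  have cS0 : #|S0| < #|A| by apply: proper_card.
  have [|S S_S0|s1 [s1P s1inj]] := IH S0 B; first by lia.
    by apply: hallA; apply: subset_trans S0sub.
  have cD : #|A :\: S0| <= m.
    have := cardsD A S0; rewrite (setIidPr S0sub).
    by move: S0n0; rewrite -card_gt0; lia.
  have [S SA|s2 [s2P s2inj]] := IH (A :\: S0) (B :\: rel_image S0) cD.
    have dis : [disjoint S & S0].
      by apply: disjointWl SA _; rewrite -setI_eq0 setIDAC setDIl setDv setI0.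
    have /hallA : S :|: S0 \subset A.
      by rewrite subUset S0sub andbT; apply: subset_trans SA (subsetDl _ _).
    rewrite rel_imageU cardsU (disjoint_setI0 dis) cards0 subn0.
    have -> : (rel_image S :|: rel_image S0) :&: B =
       (rel_image S :&: (B :\: rel_image S0)) :|: (rel_image S0 :&: B).
      apply/setP=> u; rewrite !(in_setI, in_setU, in_setD).
      by case: (u \in rel_image S); case: (u \in rel_image S0); case: (u \in B).
    by move=> /leq_trans/(_ (leq_card_setU _ _)); lia.
  exists (fun v => if v \in S0 then s1 v else s2 v); split.
    move=> v vA; case: ifPn => vS0; first exact: s1P.
    by have [] := s2P v _; rewrite ?inE ?vS0 // => /andP[].
  have cross v w : v \in S0 -> w \in A -> w \notin S0 -> s1 v != s2 w.
    move=> vS0 wA wS0; have [_ vs] := s1P v vS0.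
    have [] := s2P w; rewrite ?inE ?wS0 // => /andP[ws _] _.
    apply: contraNneq ws => <-.
    by apply/exists_inP; exists v.
  move=> v w vA wA; case: ifPn => vS0; case: ifPn => wS0.
  - exact: s1inj.
  - by move=> eq; have := cross v w vS0 wA wS0; rewrite eq eqxx.
  - by move=> eq; have := cross w v wS0 vA vS0; rewrite eq eqxx.
  - by apply: s2inj; rewrite inE ?vS0 ?wS0.
have [b bP] : exists b, b \in rel_image [set a] :&: B.
  by apply/card_gt0P; have := hallA [set a]; rewrite sub1set cards1; apply.
have cD : #|A :\ a| <= m by have := cardsD1 a A; rewrite aA; lia.
have [S SA|s [sP sinj]] := IH (A :\ a) (B :\ b) cD.
  have [->|Sn0] := eqVneq S set0; first by rewrite cards0.
  have /negbT := slack S; rewrite /= Sn0 /=.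
  have -> /= : S \proper A.
    by apply: sub_proper_trans SA _; apply: properD1.
  rewrite -ltnNge => lt.
  have -> : rel_image S :&: (B :\ b) = (rel_image S :&: B) :\ b.
    by apply/setP=> u; rewrite !inE; case: eqP; rewrite /= ?andbF.
  have := cardsD1 b (rel_image S :&: B); case: (b \in _) => /=; lia.
move: bP; rewrite inE => /andP[]; rewrite inE => /exists_inP[a' /set1P-> ab] bB.
exists (fun v => if v == a then b else s v); split.
  move=> v vA; case: eqP => [->|/eqP va] //.
  by have [] := sP v _; rewrite ?inE ?va // => /andP[].
move=> v w vA wA; case: eqP => [->|/eqP va]; case: eqP => [->|/eqP wa] //.
- move=> eb; have xA : w \in A :\ a by rewrite in_setD1 wa wA.
  by have [] := sP _ xA; rewrite -?eb ?eb !inE eqxx.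
- move=> eb; have xA : v \in A :\ a by rewrite in_setD1 va vA.
  by have [] := sP _ xA; rewrite -?eb ?eb !inE eqxx.
- by apply: sinj; rewrite in_setD1 ?va ?wa ?vA ?wA.
Qed.
End Hall.

(** The deficiency version follows by adding [def] universal vertices on the
    right. *)
Lemma hall_deficiency (T1 T2 : finType) (h : T1 -> T2 -> bool) (u0 : T2)
    (A : {set T1}) (def : nat) :
    (forall S : {set T1}, S \subset A -> #|S| <= #|rel_image h S| + def) ->
  exists (A' : {set T1}) (sigma : T1 -> T2),
    [/\ A' \subset A, #|A| <= #|A'| + def,
        forall v, v \in A' -> h v (sigma v) & {in A' &, injective sigma}].
Proof.
move=> hallA.
pose h' v (u : T2 + 'I_def) := if u is inl u then h v u else true.
have [S SA|s [sP sinj]] := @hall_restricted _ _ h' (inl u0) A setT.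
  have [->|/set0Pn[v vS]] := eqVneq S set0; first by rewrite cards0.
  have sub : [set inl u | u in rel_image h S] :|: [set inr i | i : 'I_def]
       \subset rel_image h' S :&: setT.
    rewrite setIT subUset; apply/andP; split; apply/subsetP=> x.
      move=> /imsetP[u]; rewrite inE => /exists_inP[w wS wu] ->.
      by rewrite inE; apply/exists_inP; exists w.
    by move=> /imsetP[i _ ->]; rewrite inE; apply/exists_inP; exists v.
  apply: leq_trans (hallA S SA) (leq_trans _ (subset_leq_card sub)).
  rewrite cardsU !card_imset ?card_ord; try by move=> ? ? [].
  rewrite disjoint_setI0 ?cards0 ?subn0 //.
  by apply/pred0P=> x /=; apply/negP=> /andP[/imsetP[u _ ->] /imsetP[]].
pose isl (v : T1) := if s v is inl _ then true else false.
pose sg v := if s v is inl u then u else u0.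
exists [set v in A | isl v], sg; split.
- by apply/subsetP=> v; rewrite inE => /andP[].
- rewrite -(cardsID [set v | isl v] A); apply: leq_add.
    by apply: subset_leq_card; apply/subsetP=> v; rewrite !inE.
  have <- : #|[set (inr i : T2 + 'I_def) | i : 'I_def]| = def.
    by rewrite card_imset ?card_ord //; move=> ? ? [].
  rewrite -(@card_in_imset _ _ s); last first.
    by move=> v w; rewrite !inE => /andP[_ vA] /andP[_ wA]; apply: sinj.
  apply: subset_leq_card; apply/subsetP=> x /imsetP[v]; rewrite !inE /isl.
  by case: (s v) => // i _ ->; apply: imset_f.
- move=> v; rewrite inE /isl /sg => /andP[vA]; have [_] := sP v vA.
  by case: (s v).
- move=> v w; rewrite !inE /isl /sg => /andP[vA lv] /andP[wA lw].
  move: lv lw (sinj v w vA wA).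
  by case: (s v) => // x _; case: (s w) => // y _ inj xy; apply: inj; rewrite // xy.
Qed.

(** * Disjoint paths between terminals *)

(** The part of a shortened walk before its first vertex in [X]. *)
Lemma first_hit (V : finType) (r : rel V) (X : {set V}) (z y : V) :
    connect r z y -> y \in X -> z \notin X ->
  exists p t, [/\ path r z (rcons p t), t \in X, all [predC X] p
    & uniq (z :: rcons p t)].
Proof.
move=> /connectP[p0 pth ->]; case/shortenP: pth => p pth up _ lX zX.
have hasX : has [in X] p.
  apply/hasP; exists (last z p) => //; case: p {pth up} lX zX => [|a p] /=.
    by move=> ->.
  by move=> _ _; apply: mem_last.
move: pth up; case/split_find: hasX => t p1 p2 tX p1X pth up.
exists p1, t; split => //.
- by move: pth; rewrite cat_path => /andP[].
- by rewrite all_predC.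
- by move: up; rewrite -cat_cons cat_uniq => /and3P[].
Qed.

Section TerminalPaths.
Variables (V : finType) (e : rel V).
Hypothesis e_sym : symmetric e.
Variables (S A : {set V}).
Hypothesis AS : A \subset S.

(** A component is a centre together with legs running from a terminal to the
    centre. One leg and a terminal centre make a path between two terminals;
    three legs and a non-terminal centre make a tripod. *)
Definition leg (x : V) (l : seq V) : bool :=
  if l is a :: l' then
    [&& a \in A, all [in S :\: A] l' & path e a (rcons l' x)]
  else false.

Arguments leg : simpl never.

Definition component := (V * seq (seq V))%type.

Definition is_component (c : component) : bool :=
  all (leg c.1) c.2 &&
  (if c.1 \in A then size c.2 == 1 else (c.1 \in S) && (size c.2 == 3)).

Definition support (c : component) : seq V := c.1 :: flatten c.2.

(** With these weights, linking two new terminals by a path, turning a path into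
    a tripod and trading a tripod and a new terminal for two paths are all
    gains. *)
Definition weight (c : component) : nat := if size c.2 == 1 then 2 else 3.

(** The few vertices of a component where a new leg cannot be attached. They
    will be the separator. *)
Definition tips (c : component) : seq V := c.1 :: map (head c.1) c.2.

Definition is_family (F : seq component) : bool :=
  all is_component F && uniq (flatten (map support F)).

Definition total_weight (F : seq component) : nat := sumn (map weight F).

Definition family_tips (F : seq component) : {set V} :=
  [set x in flatten (map tips F)].

Definition off (W : {set V}) : rel V :=
  [rel x y | [&& e x y, x \in S :\: W & y \in S :\: W]].

(** Deleting the tips isolates the remaining terminals from the family and from
    each other: the situation in which no augmentation is possible. *)
Definition blocked (F : seq component) : bool :=
  [forall z in A :\: [set x in flatten (map support F)],
    forall y, connect (off (family_tips F)) z y ==>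
      (y \notin flatten (map support F)) && ((y \in A) ==> (y == z))].

Lemma leg_cons x a l :
  leg x (a :: l) = [&& a \in A, all [in S :\: A] l & path e a (rcons l x)].
Proof. by []. Qed.

(** Two legs at [x] make a terminal path through [x]; the terminal of [m] becomes
    the centre. *)
Definition join (x : V) (l m : seq V) : component :=
  (head x m, [:: l ++ x :: rev (behead m)]).

Arguments join : simpl never.

Lemma support_join x l m :
  m != [::] -> perm_eq (support (join x l m)) (x :: l ++ m).
Proof.
case: m => // b m _; apply/permP=> a.
by rewrite /support /join /= cats0 /= !count_cat /= count_rev; lia.
Qed.

Lemma join_component x l m :
  x \in S -> x \notin A -> leg x l -> leg x m -> is_component (join x l m).
Proof.
move=> xS xA; case: l => // a l; case: m => // b m.
rewrite !leg_cons => /and3P[aA lS pl] /and3P[bA mS pm].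
rewrite /is_component /join /= bA !andbT leg_cons aA /= all_cat lS /= in_setD xA xS /=.
rewrite all_rev mS /= rcons_cat cat_path.
move: pl; rewrite rcons_path => /andP[-> exl] /=; rewrite exl /=.
have := rev_sorted e (b :: rcons m x).
rewrite rev_cons rev_rcons /= => ->.
by rewrite (@eq_path _ _ e) // => y z; apply: e_sym.
Qed.

Lemma leg_prefix x l1 t l2 :
  leg x (l1 ++ t :: l2) -> l1 != [::] -> leg t l1.
Proof.
case: l1 => // a l1; rewrite cat_cons leg_cons => /and3P[aA lS pl] _.
rewrite leg_cons aA; move: lS pl; rewrite all_cat rcons_cat cat_path.
by move=> /andP[-> _] /andP[p1] /= /andP[lt _]; rewrite rcons_path p1.
Qed.

Lemma leg_suffix x l1 t l2 :
  leg x (l1 ++ t :: l2) -> l1 != [::] -> x \in A -> leg t (rev (rcons l2 x)).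
Proof.
case: l1 => // a l1; rewrite cat_cons leg_cons => /and3P[aA lS pl] _ xA.
rewrite rev_rcons leg_cons xA.
move: lS pl; rewrite all_cat rcons_cat cat_path /=.
move=> /and3P[_ _ l2S] /and3P[_ _ p2]; rewrite all_rev l2S /=.
have := rev_sorted e (t :: rcons l2 x); rewrite rev_cons rev_rcons /= => ->.
by rewrite (@eq_path _ _ e) // => y z; apply: e_sym.
Qed.

Lemma family_cons c F :
  is_family (c :: F) = [&& is_component c, is_family F, uniq (support c)
    & ~~ has [in support c] (flatten (map support F))].
Proof.
rewrite /is_family; change (flatten (map support (c :: F))) with
  (support c ++ flatten (map support F)).
by rewrite cat_uniq /=; do 2 case: (uniq _) => //=; rewrite ?andbF ?andbT // -andbA.
Qed.

Lemma family_perm F F' : perm_eq F F' -> is_family F = is_family F'.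
Proof.
move=> pFF; rewrite /is_family (perm_all _ pFF); congr andb.
by apply: perm_uniq; apply/perm_flatten/perm_map.
Qed.

Lemma total_weight_perm F F' : perm_eq F F' -> total_weight F = total_weight F'.
Proof. by move=> pFF; apply/perm_sumn/perm_map. Qed.

Lemma total_weight_bound F : is_family F -> total_weight F <= 3 * #|V|.
Proof.
move=> /andP[_ uF]; apply: (@leq_trans (3 * size F)).
  elim: F {uF} => //= c F IH; rewrite /total_weight /= -/(total_weight F).
  by rewrite /weight; case: ifP => _; lia.
rewrite leq_pmul2l //; have := max_card [in flatten (map support F)].
rewrite (card_uniqP uF); apply: leq_trans.
elim: F {uF} => //= c F IH; rewrite size_cat; lia.
Qed.

Lemma component_legs c : is_component c -> c.1 \notin A ->
  exists l m m', c.2 = [:: l; m; m'] /\ [/\ leg c.1 l, leg c.1 m & leg c.1 m'].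
Proof.
move=> /andP[legs shape] cA; move: legs shape; rewrite (negPf cA).
case: c {cA} => x [|l [|m [|m' [|? ?]]]] /=; rewrite ?andbF //.
by move=> /and4P[? ? ? _] _; exists l, m, m'.
Qed.

Lemma off_path W z q :
  path (off W) z q -> path e z q && all [in S :\: W] q.
Proof.
elim: q z => //= x q IH z /andP[/and3P[-> _ xW] /IH /andP[-> ->]].
by rewrite xW.
Qed.

(** Suppose a terminal outside the family reaches, off the tips, the family or
    another such terminal. The first hit yields a new path, or turns a path
    into a tripod, or splits a tripod into two paths; each raises the total
    weight. *)
Lemma family_improve F : is_family F -> ~~ blocked F ->
  exists2 F', is_family F' & total_weight F < total_weight F'.
Proof.
move=> famF; rewrite negb_forall_in => /exists_inP[z].
rewrite in_setD inE => /andP[zU zA].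
rewrite negb_forall => /existsP[y]; rewrite negb_imply => /andP[con yP].
pose X := [set x in flatten (map support F)] :|: (A :\ z).
have yX : y \in X.
  by move: yP; rewrite !inE negb_and negb_imply negbK andbC; case/orP => ->; rewrite ?orbT.
have zX : z \notin X by rewrite !inE (negPf zU) eqxx.
have [p [t [pth tX pX up]]] := first_hit con yX zX.
have /andP[pe pSW] := off_path pth.
have /andP[tSW pS] : (t \in S :\: family_tips F) && all [in S :\: family_tips F] p.
  by move: pSW; rewrite all_rcons.
have notX x : x \notin X -> x != z -> x \notin A /\ x \notin flatten (map support F).
  rewrite !inE negb_or => /andP[-> xA] xz; split=> //.
  by move: xA; rewrite xz.
have zp : z \notin p by move: up; rewrite /= mem_rcons inE negb_or => /andP[/andP[]].
have tzp : t \notin z :: p.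
  by move: up; rewrite -rcons_cons rcons_uniq => /andP[].
have uzp : uniq (z :: p) by move: up; rewrite -rcons_cons rcons_uniq => /andP[].
have pnot x : x \in p -> x \notin A /\ x \notin flatten (map support F).
  move=> xp; apply: notX; first by move/allP: pX; apply.
  by apply: contraNneq zp => <-.
have legz : leg t (z :: p).
  rewrite leg_cons zA pe andbT /=; apply/allP=> x xp.
  have [xA _] := pnot x xp; rewrite in_setD xA.
  by move/allP: pS => /(_ x xp); rewrite in_setD => /andP[].
have dis : ~~ has [in flatten (map support F)] (z :: p).
  by apply/hasPn=> x; rewrite inE => /predU1P[->//|/pnot[]].
have [famc ufl] := andP famF.
have [tF|tF] := boolP (t \in flatten (map support F)); last first.
  have tA : t \in A by move: tX; rewrite !inE (negPf tF) => /andP[].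
  exists ((t, [:: z :: p]) :: F); last by rewrite /total_weight /weight /=; clear; lia.
  have valid : is_component (t, [:: z :: p]).
    by rewrite /is_component [all _ _]/= legz /= tA.
  rewrite family_cons valid famF has_sym.
  have -> : support (t, [:: z :: p]) = t :: z :: p by rewrite /support /= cats0.
  by rewrite cons_uniq tzp uzp /= negb_or tF.
have [c cF tc] : exists2 c, c \in F & t \in support c.
  by move/flatten_mapP: tF.
have /perm_to_rem permF := cF.
set G := rem c F in permF.
move: (famF); rewrite (family_perm permF) family_cons => /and4P[cc famG _ _].
have tW : t \notin tips c.
  move: tSW; rewrite in_setD => /andP[tW _]; apply: contra tW => tc'.
  by rewrite inE; apply/flatten_mapP; exists c.
rewrite (total_weight_perm permF).
have disG : ~~ has [in support c ++ flatten (map support G)] (z :: p).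
  apply: contra dis => /hasP[x xz xG]; apply/hasP; exists x => //.
  by rewrite /= (perm_mem (perm_flatten (perm_map support permF))).
have tS : t \in S by move: tSW; rewrite in_setD => /andP[].
(* The hit vertex lies inside a leg of c, beyond its terminal. *)
have split_leg l : l \in c.2 -> t \in l -> exists l1 l2,
    [/\ l = l1 ++ t :: l2, l1 != [::], leg c.1 l & t \notin A].
  move=> lc tl; have ll : leg c.1 l.
    by move: cc; rewrite /is_component => /andP[/allP /(_ _ lc)].
  have tl0 : t != head c.1 l.
    apply: contraNneq tW => ->; rewrite /tips inE.
    by rewrite (map_f (head c.1)) ?orbT.
  move: tl ll tl0; case: l lc => // a l lc; rewrite inE => /predU1P[->|].
    by rewrite /= eqxx.
  move=> tl ll _; move: (ll); rewrite leg_cons => /and3P[_ /allP/(_ _ tl) + _].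
  rewrite !inE => /andP[tA _].
  case/splitPr: tl ll lc => l1 l2 ll lc.
  by exists (a :: l1), l2.
have uall : uniq ((z :: p) ++ (support c ++ flatten (map support G))).
  rewrite cat_uniq uzp has_sym disG /=.
  by have := perm_uniq (perm_flatten (perm_map support permF)); rewrite ufl => /esym.
(* Replacing c by the components cs, made of the vertices of c and of the new
   leg, keeps the family disjoint; rest is what they leave out. *)
have replaced cs rest : all is_component cs ->
    perm_eq (flatten (map support cs) ++ rest) ((z :: p) ++ support c) ->
    is_family (cs ++ G).
  move=> ccs pcs; rewrite /is_family all_cat ccs map_cat flatten_cat.
  have [-> _] := andP famG.
  have : uniq ((flatten (map support cs) ++ flatten (map support G)) ++ rest).
      rewrite -(@perm_uniq _ ((z :: p) ++ (support c ++ flatten (map support G)))) //.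
    apply/permP=> a; move/permP: pcs => /(_ a).
    by rewrite !count_cat; clear; lia.
  by rewrite cat_uniq => /andP[-> _].
move: cc tc tW split_leg replaced; rewrite /is_component => /andP[legs shape].
clearbody G; clear - tS tzp uzp legz e_sym AS legs shape.
move: legs shape; case: c => x ls /=.
(* A path hit in its interior becomes a tripod centred at t. *)
have [xA|xA] := boolP (x \in A).
  case: ls => [|l [|? ?]] // /andP[ll _] _.
  rewrite /support /tips /= cats0 inE => tc tW split_leg replaced.
  have tx : t != x by apply: contraNneq tW => ->; rewrite inE eqxx.
  have tl : t \in l by move: tc; rewrite (negPf tx).
  have [|l1 [l2 [El l10 _ tA]]] := split_leg l _ tl; first by rewrite inE.
  exists ([:: (t, [:: z :: p; l1; rev (rcons l2 x)])] ++ G); last first.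
    by rewrite /total_weight /= /weight /=; clear; lia.
  apply: (replaced _ [::]).
    rewrite /= /is_component (negPf tA) tS /= legz !andbT.
    move: ll; rewrite El => ll.
    by rewrite (leg_prefix ll l10) (leg_suffix ll l10 xA).
  rewrite El; apply/permP=> a.
  rewrite /support /= !cats0 /= !count_cat /= !count_cat count_rev /=.
  by rewrite -cats1 !count_cat /=; clear; lia.
(* A tripod hit on a leg splits there: the outer part of the leg joins the new
   leg, and the two other legs make a path. *)
move=> legs shape tc tW split_leg replaced.
have {shape} /andP[xS /eqP shape] : (x \in S) && (size ls == 3) by [].
have tx : t != x by apply: contraNneq tW => ->; rewrite /tips inE eqxx.
have {tc} /flattenP[l lls tl] : t \in flatten ls.
  by move: tc; rewrite /support inE (negPf tx).
have [l1 [l2 [El l10 ll tA]]] := split_leg l lls tl.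
have /perm_to_rem permls := lls.
have [m [m' Em]] : exists m m', rem l ls = [:: m; m'].
  move: (perm_size permls); rewrite shape.
  by case: (rem l ls) => [|m [|m' [|? ?]]] //; exists m, m'.
rewrite Em in permls.
have /and4P[_ lm lm' _] : all (leg x) [:: l; m; m'] by rewrite -(perm_all _ permls).
exists ([:: join t (z :: p) l1; join x m m'] ++ G); last first.
  by rewrite /total_weight /join /= /weight /= shape /=; clear; lia.
apply: (replaced _ l2).
  apply/and3P; split=> //; apply: join_component => //.
  by apply: (@leg_prefix x _ _ l2) => //; rewrite -El.
have m'0 : m' != [::] by case: (m') lm'.
apply/permP=> a; rewrite [flatten (map _ _)](_ : _ =
  support (join t (z :: p) l1) ++ (support (join x m m') ++ [::])) //.
rewrite cats0 !count_cat (permP (support_join t (z :: p) l10)) (permP (support_join x m m'0)).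
have := permP (perm_flatten permls) a; rewrite /support El /=.
by rewrite !count_cat /= ?count_cat /=; clear; lia.
Qed.

(** The weight of a family is bounded, so augmentation stops. *)
Lemma blocked_family : exists2 F, is_family F & blocked F.
Proof.
suff H n F : is_family F -> 3 * #|V| - total_weight F <= n ->
    exists2 F, is_family F & blocked F.
  by apply: (H (3 * #|V|) [::]); rewrite // leq_subr.
elim: n F => [|n IH] F famF.
  move=> bF; have [blF|/family_improve[]] := boolP (blocked F); first by exists F.
  - by [].
  - by move=> F' /total_weight_bound; lia.
move=> bF; have [blF|/family_improve[]] := boolP (blocked F); first by exists F.
- by [].
- by move=> F' famF' lt; apply: (IH F') => //; have := total_weight_bound famF'; lia.
Qed.

Definition terminal_path (q : V * seq V * V) : bool :=
  [&& q.1.1 \in A, q.2 \in A, all [in S :\: A] q.1.2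
    & path e q.1.1 (rcons q.1.2 q.2)].

Definition vertices_of (q : V * seq V * V) : seq V :=
  q.1.1 :: rcons q.1.2 q.2.

(** A tripod contains a terminal path; dropping its third leg costs a constant
    factor only. *)
Lemma component_path c : is_component c ->
  exists2 q, terminal_path q & exists r, perm_eq (vertices_of q ++ r) (support c).
Proof.
case: c => x ls; have [xA|xA] := boolP (x \in A) => cc.
  move: cc; rewrite /is_component xA => /andP[legs /eqP].
  case: ls legs => [|l [|? ?]] //= /andP[ll _] _.
  case: l ll => // a l; rewrite leg_cons => /and3P[aA lS pl].
  exists (a, l, x); first by rewrite /terminal_path /= aA xA lS.
  exists [::]; rewrite cats0 /vertices_of /support /= cats0.
  by rewrite -rcons_cons perm_rcons.
have [l [m [m' /= [-> [ll lm lm']]]]] := component_legs cc xA.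
have xS : x \in S by move: cc; rewrite /is_component (negPf xA) => /and3P[].
have := join_component xS xA ll lm; rewrite /join.
case: l ll => // a l ll; case: m lm => // b m; rewrite leg_cons => /and3P[bA _ _].
rewrite /is_component /join /= bA !andbT leg_cons => /and3P[aA lS pl].
exists (a, l ++ x :: rev m, b); first by rewrite /terminal_path /= aA bA lS.
exists m'; apply/permP=> c; rewrite /vertices_of /support /= cats0.
by rewrite -cats1 !count_cat /= ?count_cat /= count_rev; clear; lia.
Qed.

Lemma tips_terminals c x : is_component c -> x \in support c -> x \in A ->
  x \in tips c.
Proof.
move=> /andP[legs _]; rewrite !inE; case: eqP => //= _.
move=> /flattenP[l lc xl] xA; apply/mapP; exists l => //.
move/allP: legs => /(_ l lc); case: l xl {lc} => // a l.
rewrite inE => /predU1P[//|xl]; rewrite leg_cons => /and3P[_ /allP/(_ _ xl)].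
by rewrite !inE xA.
Qed.

Lemma size_tips c : is_component c -> size (tips c) <= 4.
Proof.
by rewrite /is_component /tips /= size_map; case: ifP => _ /andP[_]; [|move=> /andP[_]]; move=> /eqP->.
Qed.

(** A one-sided approximate form of Gallai's min-max theorem for disjoint paths
    between terminals: the tips of a blocked family are the separator [W], and
    [Z] consists of the terminals that the family misses. *)
Lemma terminal_path_packing : exists (Q : seq (V * seq V * V)) (W Z : {set V}),
  [/\ all terminal_path Q, uniq (flatten (map vertices_of Q)), W \subset S,
      #|W| <= 4 * size Q & [/\ Z \subset A :\: W, #|A| <= 4 * size Q + #|Z|
    & {in Z &, forall z z', connect (off W) z z' -> z = z'}]].
Proof.
have [F famF blF] := blocked_family.
have [famc uF] := andP famF.
have [Q [tQ sQ [r pQ]]] : exists Q, [/\ all terminal_path Q, size Q = size F &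
    exists r, perm_eq (flatten (map vertices_of Q) ++ r) (flatten (map support F))].
  elim: F famc {famF blF uF} => [|c F IH].
    by move=> _; exists [::]; split => //; exists [::].
  move=> /andP[/component_path[q tq [r pq]] /IH[Q [tQ sQ [r' pQ]]]].
  exists (q :: Q); split; [by rewrite /= tq tQ|by rewrite /= sQ|exists (r ++ r')].
  apply/permP=> a; move/permP: pq => /(_ a); move/permP: pQ => /(_ a).
  change (flatten (map vertices_of (q :: Q))) with
    (vertices_of q ++ flatten (map vertices_of Q)).
  change (flatten (map support (c :: F))) with (support c ++ flatten (map support F)).
  by rewrite !count_cat; clear; lia.
pose Z := A :\: [set x in flatten (map support F)].
have cW : #|family_tips F| <= 4 * size Q.
  rewrite sQ; apply: (@leq_trans (size (flatten (map tips F)))).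
    by rewrite cardsE; apply: card_size.
  elim: F famc {famF blF uF sQ pQ Z} => // c F IH /andP[/size_tips sc /IH {}IH].
  change (size (tips c ++ flatten (map tips F)) <= 4 * (size F).+1).
  by rewrite size_cat; move: sc IH; clear; lia.
have tF x : x \in A -> x \in flatten (map support F) -> x \in family_tips F.
  move=> xA /flatten_mapP[c cF xc]; rewrite inE; apply/flatten_mapP; exists c => //.
  by apply: tips_terminals => //; apply: (allP famc).
exists Q, (family_tips F), Z; split => //.
- by move: uF; rewrite -(perm_uniq pQ) cat_uniq => /andP[].
- apply/subsetP=> x; rewrite inE => /flatten_mapP[c cF].
  have := allP famc _ cF; rewrite /is_component => /andP[legs shape].
  rewrite inE => /predU1P[->|/mapP[l lc ->]].
    by move: shape; case: ifP => [xA _|_ /andP[]//]; apply: (subsetP AS).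
  have := allP legs _ lc; case: l {lc} => // a l.
  by rewrite leg_cons => /and3P[aA _ _]; apply: (subsetP AS).
split.
- apply/subsetP=> x; rewrite !in_setD inE => /andP[xF ->]; rewrite andbT.
  apply: contra xF; rewrite inE => /flatten_mapP[c cF xc]; apply/flatten_mapP.
  exists c => //; move: xc; rewrite /tips inE => /predU1P[->|/mapP[l lc ->]].
    by rewrite inE eqxx.
  have := allP famc _ cF => /andP[/allP/(_ _ lc)]; case: l lc => // a l lc _ _.
  by rewrite inE; apply/orP; right; apply/flattenP; exists (a :: l); rewrite // inE eqxx.
- rewrite -(cardsID [set x in flatten (map support F)] A) leq_add2r.
  apply: leq_trans cW; apply: subset_leq_card; apply/subsetP=> x.
  by rewrite in_setI => /andP[xA]; rewrite inE; apply: tF.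
- move=> z z' zZ; rewrite in_setD => /andP[_ z'A] con.
  move/forall_inP: blF => /(_ z zZ) /forallP/(_ z').
  by rewrite con z'A /= => /andP[_ /eqP].
Qed.
End TerminalPaths.

(** * Linking terminals through a pseudo-random reservoir *)

(** A maximal [T] whose images overlap little: an element of [U] a
    quarter of whose image is new could be added. *)
Lemma greedy_cover (V V' : finType) (F : V -> {set V'}) (U : {set V}) (d : nat) :
    0 < d ->
  exists T : {set V}, [/\ T \subset U, d * #|T| <= 4 * #|\bigcup_(t in T) F t|
    & forall u, u \in U -> 4 * #|F u :\: \bigcup_(t in T) F t| < d].
Proof.
move=> d0.
pose P (T : {set V}) := (T \subset U) && (d * #|T| <= 4 * #|\bigcup_(t in T) F t|).
have P0 : P set0 by rewrite /P sub0set cards0 muln0.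
case: (arg_maxnP (fun T : {set V} => #|T|) P0) => T /andP[TU dT] maxT.
exists T; split=> // u uU; rewrite ltnNge; apply/negP => large.
have uT : u \notin T.
  apply/negP => uT; move: large.
  suff -> : F u :\: \bigcup_(t in T) F t = set0 by rewrite cards0 muln0 leqNgt d0.
  by apply/eqP; rewrite setD_eq0; apply: bigcup_sup.
suff /maxT : P (u |: T) by rewrite /= cardsU1 uT add1n ltnn.
rewrite /P subUset sub1set uU TU cardsU1 uT /=.
rewrite bigcup_setU big_set1.
set X := \bigcup_(t in T) F t in dT large *.
have := cardsUI (F u) X; have := cardsID X (F u).
by move: dT large; clear; lia.
Qed.

Lemma card_setU_le (V : finType) (X Y : {set V}) : #|X :|: Y| <= #|X| + #|Y|.
Proof. exact: leq_card_setU. Qed.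

Lemma leq_card_bigcup (V V' : finType) (B : {set V}) (F : V -> {set V'}) :
  #|\bigcup_(v in B) F v| <= \sum_(v in B) #|F v|.
Proof.
apply: (big_ind2 (fun X m => #|X : {set V'}| <= m)) => [|X m Y n hX hY|v _] //.
  by rewrite cards0.
by apply: leq_trans (card_setU_le X Y) (leq_add hX hY).
Qed.

Section Reservoir.
Variables (V : finType) (E : rel V).
Hypothesis E_sym : symmetric E.

Definition nbhd (v : V) : {set V} := [set w | E v w].

Definition nbhds (T : {set V}) : {set V} := \bigcup_(t in T) nbhd t.

Definition saturated (d : nat) (T : {set V}) : {set V} :=
  [set v | 4 * #|nbhd v :\: nbhds T| < d].

(** A set [U] that the greedy choice covers by [T] lies in [saturated d T]. The hull
    is thus an approximation of [U] and of its neighbourhood that depends on the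
    small set [T] only. *)
Definition hull (d : nat) (T : {set V}) : {set V} := nbhds T :|: saturated d T.

Lemma in_nbhd v w : (w \in nbhd v) = E v w.
Proof. by rewrite inE. Qed.

Lemma nbhdsP (T : {set V}) w :
  reflect (exists2 t, t \in T & E t w) (w \in nbhds T).
Proof.
by apply: (iffP bigcupP) => -[t tT]; rewrite ?in_nbhd => tw; exists t; rewrite ?in_nbhd.
Qed.

(** Double counting of the edges between [X] and [Y]. The factors [k] and [l] stand
    for denominators. *)
Lemma double_count (X Y : {set V}) a b k l :
    (forall x, x \in X -> a <= k * #|nbhd x :&: Y|) ->
    (forall y, y \in Y -> l * #|nbhd y :&: X| <= b) ->
  l * (a * #|X|) <= k * (b * #|Y|).
Proof.
move=> hX hY; have cnt (Z Z' : {set V}) :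
    \sum_(x in Z) #|nbhd x :&: Z'| = \sum_(x in Z) \sum_(y in Z') E x y.
  apply: eq_bigr => x _; rewrite -sum1dep_card [RHS]big_mkcond /= big_mkcond /=.
  by apply: eq_bigr => y _; rewrite in_nbhd; case: (E x y); case: (y \in Z').
have sumXY : \sum_(x in X) #|nbhd x :&: Y| = \sum_(y in Y) #|nbhd y :&: X|.
  rewrite !cnt exchange_big /=; apply: eq_bigr => y _; apply: eq_bigr => x _.
  by rewrite E_sym.
have h1 : a * #|X| <= k * \sum_(x in X) #|nbhd x :&: Y|.
  by rewrite mulnC -sum_nat_const big_distrr /=; apply: leq_sum.
have h2 : l * \sum_(y in Y) #|nbhd y :&: X| <= b * #|Y|.
  by rewrite [b * _]mulnC -sum_nat_const big_distrr /=; apply: leq_sum.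
rewrite -sumXY in h2; move: h1 h2; set s := \sum_(x in X) _ => h1 h2.
apply: leq_trans (leq_mul (leqnn l) h1) _; rewrite mulnCA.
by rewrite leq_mul2l h2 orbT.
Qed.

(** The pseudo-random properties of a random vertex set of density [1/N] on
    which everything below rests. Each is a lower or upper tail for the trace on
    [R] of a set, or of a matching, determined by a vertex or by [T] and [B]. The
    conditions on [T] and [B] make these sets large compared with [#|T| + #|B|],
    which is what a union bound over [T] and [B] requires. *)
Definition good_reservoir (d N b kap : nat) (R : {set V}) : Prop :=
  [/\ forall v, d <= 2 * N * #|nbhd v :&: R|,
      forall T B : {set V}, N * b * (#|T| + #|B|) <= #|nbhds T :&: nbhds B| ->
        #|nbhds T :&: nbhds B| <= 2 * N * #|nbhds T :&: nbhds B :&: R|,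
      forall T : {set V}, T != set0 -> d * #|T| <= 4 * #|nbhds T| ->
        256 * N * #|R :\: hull d T| <= maxn (512 * #|~: hull d T|) (2 * #|V|)
    & forall T : {set V}, T != set0 -> d * #|T| <= 4 * #|nbhds T| ->
        #|V| <= 64 * #|~: hull d T| ->
      exists (Y0 : {set V}) (g : V -> V),
        [/\ Y0 \subset hull d T :&: R, {in Y0 &, injective g},
            forall y, y \in Y0 -> g y \in R :\: hull d T /\ E y (g y)
          & kap * #|T| <= #|Y0|] ].

Section Separation.
Variables (d N b kap : nat) (R A : {set V}).
Let S := R :|: A.
Hypotheses (b_gt0 : 0 < b) (N_gt0 : 0 < N).
Hypothesis d_large : 100 * 500 * (N * b) <= d.
Hypothesis kap_large : 1000 * b <= kap.
Hypothesis min_deg : forall v, d <= #|nbhd v|.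
Hypothesis max_deg : forall v, #|nbhd v| <= 2 * d.
Hypothesis goodR : good_reservoir d N b kap R.
Hypothesis deg_S : forall v, N * #|nbhd v :&: S| <= 12 * d.

Let d_gt0 : 0 < d.
Proof. by have := muln_gt0 N b; rewrite N_gt0 b_gt0; lia. Qed.

(** The exceptional vertices: most of their neighbours lie in [nbhds T], but the
    reservoir retains atypically few of these. *)
Definition starved (T : {set V}) : {set V} :=
  [set v in S :&: saturated d T | 16 * N * #|nbhd v :&: (nbhds T :&: R)| < d].

(** For a second greedy choice [B] among the starved vertices, the set
    [nbhds T :&: nbhds B] meets [R] in too few vertices, so it is small by the
    second property of [R]. But every starved vertex has half of its neighbours in
    this set, while the degrees into [S] are bounded; so few vertices are
    starved. *)
Lemma card_starved T : #|starved T| <= 48 * (b * #|T|).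
Proof.
have [B [BS dB coverB]] :=
  @greedy_cover _ _ (fun v => nbhd v :&: nbhds T) (starved T) d d_gt0.
set X := \bigcup_(t in B) _ in dB coverB.
have XE : X = nbhds T :&: nbhds B.
  apply/setP=> x; apply/bigcupP/setIP => [[v vB]|[xT /bigcupP[v vB xv]]].
    by rewrite in_setI => /andP[xv xT]; split=> //; apply/bigcupP; exists v.
  by exists v => //; rewrite in_setI xv.
have satB v : v \in starved T -> 4 * #|nbhd v :\: nbhds T| < d.
  by rewrite !inE => /andP[/andP[_]].
have [_ R2 _ _] := goodR.
have XR : 16 * N * #|X :&: R| + #|B| <= d * #|B|.
  have -> : X :&: R = \bigcup_(v in B) (nbhd v :&: (nbhds T :&: R)).
    rewrite big_distrl /=; apply: eq_bigr => v _; by rewrite setIA.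
  apply: (@leq_trans (16 * N * (\sum_(v in B) #|nbhd v :&: (nbhds T :&: R)|) + #|B|)).
    by rewrite leq_add2r leq_mul2l leq_card_bigcup orbT.
  rewrite big_distrr /= -sum1_card -big_split /= big_distrr /= muln1.
  apply: leq_sum => v vB; have := subsetP BS v vB.
  by rewrite inE addn1 => /andP[].
have smallX : #|X| <= N * b * (#|T| + #|B|).
  rewrite leqNgt; apply/negP => lt; have := R2 T B; rewrite -XE => /(_ (ltnW lt)) XR2.
  have X0 : #|X| = 0 by move: XR XR2 dB; clear; nia.
  by move: lt; rewrite X0 ltn0.
have B_le : #|B| <= #|T|.
  by move: smallX dB d_large; rewrite -!mulnA; move: (N * b) N_gt0 b_gt0; nia.
have half v : v \in starved T -> d <= 2 * #|nbhd v :&: X|.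
  move=> vS; have := satB v vS; have := coverB v vS; have := min_deg v.
  have := cardsID (nbhds T) (nbhd v); have := cardsID X (nbhd v :&: nbhds T).
  have -> : nbhd v :&: nbhds T :&: X = nbhd v :&: X.
    by rewrite -setIA; congr setI; rewrite XE setIA setIid.
  by clear; lia.
have degX x : x \in X -> N * #|nbhd x :&: starved T| <= 12 * d.
  move=> _; apply: leq_trans (deg_S x); rewrite leq_mul2l; apply/orP; right.
  apply/subset_leq_card/setIS/subsetP=> v; rewrite inE => /andP[].
  by rewrite inE => /andP[].
have := double_count half degX.
have : N * b * (#|T| + #|B|) <= N * (2 * (b * #|T|)).
  by rewrite -mulnA leq_mul2l; apply/orP; right; nia.
move: smallX; move: #|X| => x; move: #|starved T| => s.
move: d_gt0 N_gt0; clear => d0 N0 h1 h2 h3.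
have h4 : N * s <= 24 * x.
  rewrite -(@leq_pmul2l d) //; apply: leq_trans (_ : _ <= 2 * (12 * d * x)) _.
    by apply: leq_trans h3; rewrite mulnCA.
  by rewrite !mulnA; nia.
rewrite -(@leq_pmul2l N) //; apply: leq_trans h4 _.
by move: (leq_trans h1 h2); clear; lia.
Qed.

(** [U] is a union of components of [S] minus [W]. The greedy set [T] inside [U]
    makes [hull d T] a shadow of [U] in the whole graph: a vertex of [R] in the hull
    belongs to [U] or [W], unless it is starved or has many neighbours in [W].
    As [U] contains at most half of [R], the hull misses a constant fraction of the
    graph, and the fourth property of [R] gives [kap * #|T|] disjoint edges of
    [R] that leave the hull. None leaves [U] without meeting [W], so
    [b * #|T|], and with it the number of starved vertices, is at most of order
    [#|W|]. A vertex of [Z] is starved, or has many neighbours in [W], or reaches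
    [T]; the last happens at most [#|T|] times. *)
Lemma separated_side (W U Z : {set V}) :
    W \subset S -> U \subset S :\: W ->
    (forall u x, u \in U -> x \in S :\: W -> E u x -> x \in U) ->
    2 * #|U :&: R| <= #|R| -> Z \subset U ->
    {in Z &, forall z z', connect (off E S W) z z' -> z = z'} ->
  #|Z| <= 100 * 800 * #|W|.
Proof.
move=> WS US closedU halfU ZU sepZ; set w := #|W|.
have [->|/set0Pn[z0 z0Z]] := eqVneq Z set0; first by rewrite cards0.
have [T [TU dT coverU]] := greedy_cover nbhd U d_gt0.
rewrite -/(nbhds T) in dT coverU.
have T_n0 : T != set0.
  apply/eqP => T0; have := coverU z0 (subsetP ZU _ z0Z).
  by rewrite /nbhds T0 big_set0 setD0; have := min_deg z0; lia.
have [R1 R2 R3 R4] := goodR.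
have satU u : u \in U -> u \in saturated d T by rewrite inE; apply: coverU.
have TR x : x \in nbhds T -> x \in S -> x \notin W -> x \in U.
  move=> /nbhdsP[t tT tx] xS xW; apply: (closedU t); rewrite ?in_setD ?xW //.
  exact: (subsetP TU).
have RS x : x \in R -> x \in S by move=> xR; rewrite in_setU xR.
pose B := starved T.
have cB : #|B| <= 48 * (b * #|T|) := card_starved T.
(* A vertex outside U may see nbhds T inside R, but only through W. *)
pose G := [set v in S | d <= 16 * N * #|nbhd v :&: W|].
have cG : #|G| <= 192 * w.
  have hG v : v \in G -> d <= 16 * N * #|nbhd v :&: W|.
    by rewrite inE => /andP[].
  have hW x : x \in W -> N * #|nbhd x :&: G| <= 12 * d.
    move=> _; apply: leq_trans (deg_S x); rewrite leq_mul2l; apply/orP; right.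
    by apply/subset_leq_card/setIS/subsetP=> v; rewrite inE => /andP[].
  have := double_count hG hW; rewrite -/w => h.
  rewrite -(@leq_pmul2l (N * d)) ?muln_gt0 ?N_gt0 //.
  by move: h; clear; nia.
have satBG v : v \in S -> v \notin W -> v \notin U -> v \in saturated d T ->
    v \in B :|: G.
  move=> vS vW vU vsat; rewrite in_setU; case: (boolP (v \in B)) => //= vB.
  rewrite inE vS /=; move: vB; rewrite inE in_setI vS vsat /= -leqNgt.
  move/leq_trans; apply; rewrite leq_mul2l; apply/orP; right.
  apply/subset_leq_card/subsetP=> x; rewrite !in_setI => /and3P[vx xT xR].
  rewrite vx /=; apply: contraR vU => xW.
  have xU := TR x xT (RS x xR) xW.
  by apply: (closedU x); rewrite ?in_setD ?vW // E_sym -in_nbhd.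
have hullR y : y \in hull d T -> y \in R -> y \in U :|: W :|: (B :|: G).
  rewrite {1}/hull in_setU => yT yR; rewrite 2!in_setU.
  have [//|yU] := boolP (y \in U); have [//|yW] := boolP (y \in W).
  case/orP: yT => [yT|ysat]; first by rewrite (TR y) ?RS in yU.
  exact: satBG (RS y yR) yW yU ysat.
have cBG : #|B :|: G| <= 48 * (b * #|T|) + 192 * w.
  exact: leq_trans (card_setU_le _ _) (leq_add cB cG).
have degT : d * #|V| <= 4 * N * (d * #|R|).
  have h v : v \in [set: V] -> d <= 2 * N * #|nbhd v :&: R| by move=> _.
  have h' v : v \in R -> 1 * #|nbhd v :&: setT| <= 2 * d.
    by move=> _; rewrite setIT mul1n.
  by have := double_count h h'; rewrite cardsT; clear; lia.
have {degT} cR : #|V| <= 4 * (N * #|R|).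
  by rewrite -(leq_pmul2l d_gt0); move: degT; clear; nia.
have cT : 100 * 500 * (N * (b * #|T|)) <= 4 * #|V|.
  apply: leq_trans (_ : d * #|T| <= _); last first.
    by apply: leq_trans dT _; rewrite leq_mul2l max_card orbT.
  by rewrite !mulnA leq_mul2r -!mulnA mulnA d_large orbT.
(* If W is not small compared with the whole of S, the claim is trivial. *)
have [small|large] := leqP (386 * 16 * (N * w)) #|V|; last first.
  have h x : x \in S -> d <= 1 * #|nbhd x :&: setT|.
    by move=> _; rewrite setIT mul1n.
  have h' y : y \in [set: V] -> N * #|nbhd y :&: S| <= 12 * d by move=> _.
  have NS : N * #|S| <= 12 * #|V|.
    rewrite -(leq_pmul2l d_gt0); move: (double_count h h'); rewrite cardsT.
    by clear; nia.
  have /subset_leq_card ZS : Z \subset S.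
    by apply: subset_trans ZU (subset_trans US (subsetDl _ _)).
  rewrite -(leq_pmul2l N_gt0) -/w; move: large NS ZS; clear.
  by move: #|Z| #|S| => z s; nia.
(* Otherwise the hull misses a large part of R, hence of the graph. *)
have big_hull : #|V| <= 64 * #|~: hull d T|.
  have RY : #|R :\: hull d T| + #|U :&: R| + w + #|B :|: G| >= #|R|.
    rewrite -addnA -addnA -(cardsID (hull d T) R) addnC leq_add2l.
    apply: leq_trans (_ : #|(U :&: R) :|: (W :|: (B :|: G))| <= _).
      apply/subset_leq_card/subsetP=> y; rewrite in_setI => /andP[yR yT].
      have := hullR y yT yR; rewrite !in_setU in_setI yR andbT -!orbA.
      by [].
    apply: leq_trans (card_setU_le _ _) _; rewrite leq_add2l.
    exact: card_setU_le.
  have := R3 T T_n0 dT.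
  move: RY halfU cBG cR cT small; rewrite -/w.
  move: #|R :\: _| #|U :&: R| #|B :|: G| #|R| #|V| #|~: _| (b * #|T|).
  clear => ry u bg r n c t RY halfU cBG cR cT small.
  rewrite leq_max; have hN : N * (r + r) <= N * (2 * ry + r + 2 * w + 2 * bg).
    by rewrite leq_mul2l; apply/orP; right; lia.
  have hN2 : N * bg <= N * (48 * t + 192 * w) by rewrite leq_mul2l cBG orbT.
  by case/orP; nia.
have [Y0 [g [Y0sub ginj gP kapT]]] := R4 T T_n0 dT big_hull.
have cY0 : #|Y0| <= 194 * w + 48 * (b * #|T|).
  have sub : Y0 \subset (W :|: (B :|: G)) :|: [set y in Y0 | g y \in W].
    apply/subsetP=> y yY; have := subsetP Y0sub y yY; rewrite in_setI => /andP[yT yR].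
    have := hullR y yT yR; rewrite -setUA in_setU => /orP[yU|yW]; last first.
      by rewrite in_setU yW.
    rewrite in_setU inE yY /=; apply/orP; right; apply/negPn/negP => gW.
    have [] := gP y yY; rewrite in_setD => /andP[gT gR] yg.
    have gU : g y \in U by apply: (closedU y) => //; rewrite in_setD gW RS.
    by move: gT; rewrite in_setU satU ?orbT.
  have cg : #|[set y in Y0 | g y \in W]| <= w.
    rewrite -(@card_in_imset _ _ g); last first.
      by move=> y y'; rewrite !inE => /andP[? _] /andP[? _]; apply: ginj.
    by apply/subset_leq_card/subsetP=> x /imsetP[y]; rewrite inE => /andP[_ ?] ->.
  have := subset_leq_card sub; have := card_setU_le W (B :|: G).
  have := card_setU_le (W :|: (B :|: G)) [set y in Y0 | g y \in W].
  by rewrite -/w; move: cg cBG; clear; lia.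
have bT : 4 * (b * #|T|) <= w.
  have : 1000 * (b * #|T|) <= kap * #|T| by rewrite mulnA leq_mul2r kap_large orbT.
  by move: cY0 kapT; clear; lia.
have TbT : #|T| <= b * #|T| by rewrite leq_pmull.
(* Different elements of Z reach different elements of T. *)
pose Z1 := [set z in Z | [exists t in T, connect (off E S W) z t]].
have cZ1 : #|Z1| <= #|T|.
  pose f z := odflt z [pick t in T | connect (off E S W) z t].
  have fP z : z \in Z1 -> f z \in T /\ connect (off E S W) z (f z).
    rewrite inE /f => /andP[_ /exists_inP[t tT zt]].
    by case: pickP => [t' /andP[]|/(_ t)] //=; rewrite tT zt.
  rewrite -(@card_in_imset _ _ f); last first.
    move=> z z' zZ z'Z ff; have [_ zf] := fP z zZ; have [_ zf'] := fP z' z'Z.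
    apply: sepZ; try by [move: zZ; rewrite inE => /andP[] | move: z'Z; rewrite inE => /andP[]].
    apply: connect_trans zf _; rewrite ff sym_connect_sym //.
    by move=> x y; rewrite /off /= E_sym [X in _ && X]andbC.
  by apply/subset_leq_card/subsetP=> x /imsetP[z /fP[fT _] ->].
have sub : Z \subset Z1 :|: (B :|: G).
  apply/subsetP=> z zZ; rewrite in_setU; case: (boolP (z \in Z1)) => //= zZ1.
  have zU := subsetP ZU z zZ; have := subsetP US z zU; rewrite in_setD => /andP[zW zS].
  rewrite in_setU; case: (boolP (z \in B)) => //= zB.
  rewrite inE zS /=; move: zB; rewrite inE in_setI zS satU //= -leqNgt.
  move/leq_trans; apply; rewrite leq_mul2l; apply/orP; right.
  apply/subset_leq_card/subsetP=> x; rewrite !in_setI => /and3P[zx xT xR].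
  rewrite zx /=; apply: contraR zZ1 => xW; rewrite inE zZ; apply/exists_inP.
  have /nbhdsP[t tT tx] := xT; exists t => //.
  have := subsetP US t (subsetP TU t tT); rewrite in_setD => /andP[tW tS].
  apply: (@connect_trans _ _ x); apply: connect1.
    by move: zx; rewrite in_nbhd /off /= !in_setD zW zS xW RS // => ->.
  by rewrite /off /= !in_setD tW tS xW RS // E_sym tx.
have := subset_leq_card sub; have := card_setU_le Z1 (B :|: G).
by rewrite -/w; move: cZ1 cBG bT TbT; clear; lia.
Qed.

Lemma half_subset (Z : {set V}) :
  exists2 Z1 : {set V}, Z1 \subset Z & #|Z1| = #|Z|./2.
Proof.
exists [set x in take #|Z|./2 (enum Z)].
  by apply/subsetP=> x; rewrite inE => /mem_take; rewrite mem_enum.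
rewrite cardsE (card_uniqP (take_uniq _ (enum_uniq _))) size_takel // -cardE.
by rewrite -{2}(odd_double_half #|Z|) -addnn addnA leq_addl.
Qed.

(** Of two disjoint unions of components, one has at most half of [R]. *)
Lemma separated_terminals (W Z : {set V}) :
    W \subset S -> Z \subset S :\: W ->
    {in Z &, forall z z', connect (off E S W) z z' -> z = z'} ->
  #|Z| <= 2 * (100 * 800 * #|W|) + 1.
Proof.
move=> WS ZS sepZ; have [Z1 Z1Z cZ1] := half_subset Z.
have csym : connect_sym (off E S W).
  apply: sym_connect_sym => x y.
  by rewrite /off /= E_sym [X in _ && X]andbC.
pose U (X : {set V}) :=
  [set x in S :\: W | [exists z in X, connect (off E S W) z x]].
have side (X : {set V}) : X \subset Z -> 2 * #|U X :&: R| <= #|R| ->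
    #|X| <= 100 * 800 * #|W|.
  move=> XZ half; apply: (@separated_side W (U X)) => //.
  - by apply/subsetP=> x; rewrite inE => /andP[].
  - move=> u x; rewrite !inE => /andP[/andP[uW uS] /exists_inP[z zX zu]] xSW ux.
    rewrite xSW /=; apply/exists_inP; exists z => //.
    apply: connect_trans zu (connect1 _).
    by rewrite /off /= !inE ux uW uS.
  - apply/subsetP=> x xX; rewrite inE (subsetP ZS) ?(subsetP XZ) //=.
    by apply/exists_inP; exists x.
  - by move=> z z' zX z'X; apply: sepZ; apply: (subsetP XZ).
have dis : U Z1 :&: U (Z :\: Z1) = set0.
  apply/setP=> x; rewrite in_setI [x \in U _]inE [x \in U (Z :\: _)]inE in_set0.
  apply/negP=> /andP[/andP[_ /exists_inP[z zZ1 zx]] /andP[_ /exists_inP[z' + z'x]]].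
  rewrite in_setD => /andP[z'Z1 z'Z]; apply/negP: z'Z1; apply/negPn.
  suff <- : z = z' by [].
  by apply: sepZ => //; [apply: (subsetP Z1Z)|apply: connect_trans zx _; rewrite csym].
have tot : #|U Z1 :&: R| + #|U (Z :\: Z1) :&: R| <= #|R|.
  rewrite -cardsUI setIACA setIid dis set0I cards0 addn0.
  by apply: subset_leq_card; rewrite -setIUl subsetIr.
have c2 : #|Z :\: Z1| = #|Z| - #|Z|./2 by rewrite cardsD (setIidPr Z1Z) cZ1.
have := odd_double_half #|Z|; rewrite -addnn.
have [h|h] := leqP (2 * #|U Z1 :&: R|) #|R|.
  have := side Z1 Z1Z h; rewrite cZ1; clear; lia.
have := side (Z :\: Z1) (subsetDl _ _).
by rewrite c2; move: h tot; clear; lia.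
Qed.

(** A linear number of disjoint paths between terminals: the extremal family
    of components cannot leave many terminals separated by its few tips. *)
Lemma linked_terminals : exists Q : seq (V * seq V * V),
  [/\ all (terminal_path E S A) Q, uniq (flatten (map (@vertices_of V) Q))
    & #|A| <= (4 + 8 * (100 * 800)) * size Q + 1].
Proof.
have AS : A \subset S by apply: subsetUr.
have [Q [W [Z [tQ uQ WS cW [ZA cA sepZ]]]]] := terminal_path_packing E_sym AS.
exists Q; split=> //; have := @separated_terminals W Z WS _ sepZ.
rewrite (subset_trans ZA) ?setSD // => /(_ isT).
by move: cW cA; clear; lia.
Qed.

End Separation.
End Reservoir.

(** * Merging paths and closing a cycle *)

Section PathSystems.
Variables (V : finType) (E : rel V) (v0 : V).
Hypothesis E_sym : symmetric E.
Variable D : {set V}.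

(** The ends of the paths are kept in a set [D] in which every vertex has
    few neighbours. *)
Definition good_path (p : seq V) : bool :=
  if p is x :: p' then
    [&& path E x p', x \in D, last x p' \in D & p' != [::]]
  else false.

Lemma good_path_merge p p' I :
    good_path p -> good_path p' ->
    path E (last v0 p) (rcons I (last v0 p')) ->
  good_path (p ++ I ++ rev p') /\ last v0 (p ++ I ++ rev p') = head v0 p'.
Proof.
case: p => // x p; case: p' => // y p' /and4P[px xD lx p0] /and4P[py yD ly q0] pI.
split; last by rewrite rev_cons !last_cat last_rcons.
have lst : last x (p ++ I ++ rev (y :: p')) = y.
  by rewrite rev_cons !last_cat last_rcons.
rewrite /good_path cat_cons lst xD yD; apply/and4P; split=> //; last first.
  by case: (p) p0.
rewrite cat_path px /= lastI rev_rcons -cat_rcons cat_path pI last_rcons /=.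
by rewrite rev_path (@eq_path _ _ E) // => a b; apply: E_sym.
Qed.

(** A connection between two last vertices merges their paths into one. The new last
    vertex is a former first vertex, so the ends of the remaining connections are
    still last vertices of different paths. *)
Lemma merge_paths (P : seq (seq V)) (Q : seq (V * seq V * V)) :
    all good_path P ->
    uniq (flatten P ++ flatten [seq q.1.2 | q <- Q]) ->
    uniq (flatten [seq [:: q.1.1; q.2] | q <- Q]) ->
    (forall q, q \in Q -> [/\ q.1.1 \in map (last v0) P, q.2 \in map (last v0) P
      & path E q.1.1 (rcons q.1.2 q.2)]) ->
  exists P', [/\ all good_path P', size P = size P' + size Q
    & perm_eq (flatten P') (flatten P ++ flatten [seq q.1.2 | q <- Q])].
Proof.
elim: Q P => [|[[a I] b] Q IH] P gP uP uQ linkP.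
  by exists P; split; rewrite ?addn0 //= cats0.
have [/= aP bP pI] := linkP _ (mem_head _ _).
move: uQ; rewrite [flatten _]/= => /and3P[aQ bQ uQ].
move: aQ; rewrite inE negb_or => /andP[ab aQ].
have /mapP[p pP Ea] := aP; have /mapP[p' p'P Eb] := bP.
have pp : p' != p by apply: contraNneq ab => pp; rewrite Ea Eb pp.
have perm1 := perm_to_rem pP.
have p'P1 : p' \in rem p P by move: p'P; rewrite (perm_mem perm1) inE (negPf pp).
have perm2 := perm_to_rem p'P1.
set P1 := rem p' (rem p P) in perm2.
have permP1 : perm_eq P (p :: p' :: P1).
  by apply: perm_trans perm1 _; rewrite perm_cons.
have := gP; rewrite (perm_all _ permP1) => /and3P[gp gp' gP1].
have [gm lm] : good_path (p ++ I ++ rev p') /\ _ :=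
  good_path_merge gp gp' (etrans (congr2 (fun x y => path E x (rcons I y))
    (esym Ea) (esym Eb)) pI).
have permF : perm_eq (flatten ((p ++ I ++ rev p') :: P1)) (flatten P ++ I).
  apply/permP=> c; rewrite [RHS]count_cat (permP (perm_flatten permP1)) /=.
  by rewrite !count_cat count_rev; clear; lia.
have permQ : perm_eq (flatten ((p ++ I ++ rev p') :: P1) ++ flatten [seq q.1.2 | q <- Q])
    (flatten P ++ flatten [seq q.1.2 | q <- (a, I, b) :: Q]).
  apply/permP=> c; rewrite [LHS]count_cat (permP permF) [count c (flatten P ++ I)]count_cat.
  by rewrite [RHS]count_cat /= [count c (I ++ _)]count_cat addnA.
have [||//|q qQ|P' [gP' sP' pP']] := IH ((p ++ I ++ rev p') :: P1).
- by rewrite /= gm.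
- by rewrite (perm_uniq permQ).
- have qQ' : q \in (a, I, b) :: Q by rewrite inE qQ orbT.
  have [q1 q2 pq] := linkP q qQ'.
  have notab x : x \in [:: q.1.1; q.2] -> x \in map (last v0) P ->
      x \in map (last v0) ((p ++ I ++ rev p') :: P1).
    move=> xq; rewrite (perm_mem (perm_map (last v0) permP1)) /= !inE.
    have xQ : x \in flatten [seq [:: q0.1.1; q0.2] | q0 <- Q].
      by apply/flatten_mapP; exists q.
    case/or3P=> [/eqP xa|/eqP xb|->]; last by rewrite orbT.
      by move: aQ; rewrite -/(flatten _) Ea -xa xQ.
    by move: bQ; rewrite -/(flatten _) Eb -xb xQ.
  by split=> //; apply: notab; rewrite // !inE eqxx ?orbT.
exists P'; split=> //.
  by rewrite (perm_size permP1); move: sP' => /=; clear; lia.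
exact: perm_trans pP' permQ.
Qed.

End PathSystems.

Section Linking.
Variables (V : finType) (E : rel V) (v0 : V).
Hypothesis E_sym : symmetric E.
Variables (d N b kap : nat) (D : {set V}).
Hypotheses (b_gt0 : 0 < b) (N_gt0 : 0 < N).
Hypothesis d_large : 100 * 500 * (N * b) <= d.
Hypothesis kap_large : 1000 * b <= kap.
Hypothesis min_deg : forall v, d <= #|nbhd E v|.
Hypothesis max_deg : forall v, #|nbhd E v| <= 2 * d.
Hypothesis deg_D : forall v, N * #|nbhd E v :&: D| <= 8 * d.

Variable C : nat.
Hypothesis C_large : 4 + 8 * (100 * 800) <= C.

Definition usable (R : {set V}) : Prop :=
  good_reservoir E d N b kap R /\ forall v, N * #|nbhd E v :&: R| <= 4 * d.

Lemma usable_links (R A : {set V}) : usable R -> A \subset D ->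
  exists Q : seq (V * seq V * V),
  [/\ all (terminal_path E (R :|: A) A) Q, uniq (flatten (map (@vertices_of V) Q))
    & #|A| <= C * size Q + 1].
Proof.
move=> [goodR deg_R] AD.
have [v|Q [tQ uQ cA]] := linked_terminals (A := A) E_sym b_gt0 N_gt0 d_large
  kap_large min_deg max_deg goodR; last first.
  exists Q; split=> //; apply: leq_trans cA _.
  by rewrite leq_add2r leq_mul2r C_large orbT.
apply: (@leq_trans (N * (#|nbhd E v :&: R| + #|nbhd E v :&: D|))).
  rewrite leq_mul2l; apply/orP; right; rewrite setIUr.
  apply: leq_trans (card_setU_le _ _) _; rewrite leq_add2l.
  exact: subset_leq_card (setIS _ AD).
by have := deg_R v; have := deg_D v; rewrite mulnDr; lia.
Qed.

Lemma last_uniq (P : seq (seq V)) : all (good_path E D) P -> uniq (flatten P) ->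
  uniq (map (last v0) P).
Proof.
elim: P => //= p P IH /andP[gp gP]; rewrite cat_uniq => /and3P[_ /hasPn pP uP].
rewrite IH // andbT; apply/mapP=> -[p' p'P eqp].
have lastin (q : seq V) : good_path E D q -> last v0 q \in q.
  by case: q => //= x q _; apply: mem_last.
have := pP (last v0 p'); rewrite -{2}eqp lastin // => /(_ _)/negP; apply=> //.
by apply/flattenP; exists p' => //; apply/lastin/(allP gP).
Qed.

Lemma flatten_gt0 (P : seq (seq V)) : all (good_path E D) P -> P != [::] ->
  0 < size (flatten P).
Proof. by case: P => // -[|x p] P /andP[]. Qed.

(** A round removes a fraction [1 / C] of the paths, one path not counted. *)
Lemma link_round (R : {set V}) (P : seq (seq V)) :
    usable R -> all (good_path E D) P -> uniq (flatten P) -> P != [::] ->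
    (forall x, x \in flatten P -> x \notin R) ->
  exists (P' : seq (seq V)) (X : seq V),
    [/\ all (good_path E D) P', P' != [::],
        C * (size P').-1 <= C.-1 * (size P).-1,
        perm_eq (flatten P') (flatten P ++ X)
      & {subset X <= R} /\ uniq (flatten P ++ X)].
Proof.
move=> uR gP uP P0 PR; pose A := [set x in map (last v0) P].
have AD : A \subset D.
  apply/subsetP=> x; rewrite inE => /mapP[p pP ->].
  by have := allP gP p pP; case: (p) => //= a p' /and4P[].
have cA : #|A| = size P.
  by rewrite cardsE (card_uniqP (last_uniq gP uP)) size_map.
have [Q [tQ uQ]] := usable_links uR AD; rewrite cA => cQ.
pose X := flatten [seq q.1.2 | q <- Q].
have permQ : perm_eq (flatten (map (@vertices_of V) Q))
    (flatten [seq [:: q.1.1; q.2] | q <- Q] ++ X).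
  rewrite /X; elim: (Q) => // -[[a I] c] Q' IH; apply/permP=> f.
  have /permP/(_ f) := IH; rewrite /= !count_cat /= -cats1 !count_cat /=.
  by clear; lia.
move: uQ; rewrite (perm_uniq permQ) cat_uniq => /and3P[uends _ uX].
have XR : {subset X <= R}.
  move=> x /flatten_mapP[q qQ xq]; have := allP tQ q qQ.
  move=> /and4P[_ _ /allP/(_ x xq) + _].
  by move=> /setDP[+ xA]; rewrite in_setU (negPf xA) orbF.
have uPX : uniq (flatten P ++ X).
  rewrite cat_uniq uP uX andbT /=; apply/hasPn=> x /XR xR.
  by apply: contraL xR => /PR.
have linkP q : q \in Q -> [/\ q.1.1 \in map (last v0) P,
    q.2 \in map (last v0) P & path E q.1.1 (rcons q.1.2 q.2)].
  by move=> qQ; have := allP tQ q qQ => /and4P[]; rewrite !inE => -> -> _ ->.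
have [P' [gP' sP pP']] := merge_paths E_sym gP uPX uends linkP.
have P'0 : P' != [::].
  apply/eqP => P'0; have := perm_size pP'; rewrite P'0 size_cat /=.
  by move: (flatten_gt0 gP P0); clear; lia.
exists P', X; split=> //.
have : 0 < size P' by case: (P') P'0.
move: sP cQ; move: (size P) (size P') (size Q).
have C0 : 0 < C by apply: leq_trans C_large.
move: C0; clear => C0 s s' k -> h s'0; rewrite -!subn1; nia.
Qed.

(** Every round uses a reservoir of its own, so that the vertices which earlier
    rounds added to the paths do not obstruct it. *)
Lemma link_rounds (R : nat -> {set V}) (s : nat) (L : {set V}) (P : seq (seq V)) :
    (forall j, j < s -> usable (R j)) ->
    (forall i j, i < j -> j <= s -> [disjoint R i & R j]) ->
    (forall j, j <= s -> [disjoint L & R j]) ->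
    all (good_path E D) P -> uniq (flatten P) -> P != [::] ->
    {subset flatten P <= L} ->
  exists P' : seq (seq V),
    [/\ all (good_path E D) P', P' != [::],
        C ^ s * (size P').-1 <= C.-1 ^ s * (size P).-1,
        uniq (flatten P') /\ size (flatten P) <= size (flatten P')
      & forall x, x \in flatten P' -> x \notin R s].
Proof.
move=> uR disR disL gP uP P0 PL.
suff rounds t : t <= s -> exists P' : seq (seq V),
    [/\ all (good_path E D) P', P' != [::],
        C ^ t * (size P').-1 <= C.-1 ^ t * (size P).-1,
        uniq (flatten P') /\ size (flatten P) <= size (flatten P')
      & forall x, x \in flatten P' -> forall j, t <= j -> j <= s -> x \notin R j].
  have [P' [gP' P'0 le uP' P'R]] := rounds s (leqnn s).
  by exists P'; split=> // x xP'; apply: P'R.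
elim: t => [|t IH] ts.
  exists P; rewrite !expn0 !mul1n; split => //.
  by move=> x /PL xL j _ js; apply: contraL xL => xR; rewrite (disjointFl (disL j js) xR).
have [P1 [gP1 P10 le1 [uP1 sz1] P1R]] := IH (ltnW ts).
have [|P2 [X [gP2 P20 le2 pP2 [XR uX]]]] := link_round (uR t ts) gP1 uP1 P10.
  by move=> x /P1R; apply=> //; apply: ltnW.
exists P2; split=> //.
- rewrite !expnS; move: le1 le2; move: (_.-1 ^ t) (C ^ t) => u v.
  move: (C.-1) (size P).-1 (size P1).-1 (size P2).-1.
  by clear => c m m1 m2; nia.
- rewrite (perm_uniq pP2) (perm_size pP2) size_cat; split=> //.
  exact: leq_trans sz1 (leq_addr _ _).
- move=> x; rewrite (perm_mem pP2) mem_cat => /orP[/P1R xR j tj js|/XR xR j tj js].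
    by apply: xR => //; apply: ltnW.
  by rewrite (disjointFr (disR t j tj js)).
Qed.

(** Once the rounds have left a single path, one more reservoir links its two
    ends. *)
Lemma link_cycle (R : nat -> {set V}) (s : nat) (L : {set V}) (P : seq (seq V)) :
    (forall j, j <= s -> usable (R j)) ->
    (forall i j, i < j -> j <= s -> [disjoint R i & R j]) ->
    (forall j, j <= s -> [disjoint L & R j]) ->
    all (good_path E D) P -> uniq (flatten P) -> P != [::] ->
    {subset flatten P <= L} ->
    C.-1 ^ s * (size P).-1 < C ^ s ->
  exists2 c, ucycle E c & size (flatten P) <= size c.
Proof.
move=> uR disR disL gP uP P0 PL few.
have [|P' [gP' P'0 le [uP' sz] P'R]] :=
  link_rounds _ disR disL gP uP P0 PL; first by move=> j /ltnW; apply: uR.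
have {le few} : (size P').-1 = 0.
  by move: few le; move: (C ^ s) (size P').-1 => u v; clear; nia.
case: P' gP' P'0 uP' sz P'R => // p [|//] /andP[gp _] _; rewrite /= cats0.
case: p gp => // x p /and4P[px xD lD p0] up sz pR _.
pose A := [set x; last x p].
have AD : A \subset D by rewrite subUset !sub1set xD lD.
have xl : x != last x p.
  by move: up; case: (p) p0 => //= y q _ /andP[xq _]; apply: contraNneq xq => ->; apply: mem_last.
have [[|[[a I] c] Q] [tQ uQ]] := usable_links (uR s (leqnn s)) AD.
  by rewrite cards2 xl muln0.
move=> _; move: tQ uQ => /andP[/and4P[/= aA cA IR pI] _].
rewrite /= mem_cat => /andP[/norP[aI _]]; rewrite cat_uniq => /andP[uI _].
have ac : a != c by apply: contraNneq aI => ->; rewrite mem_rcons mem_head.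
have IsubR y : y \in I -> y \in R s.
  move=> yI; have /setDP[+ yA] := allP IR y yI.
  by rewrite in_setU (negPf yA) orbF.
have uI' : uniq I by move: uI; rewrite rcons_uniq => /andP[].
have close J : path E (last x p) (rcons J x) -> uniq J -> {subset J <= R s} ->
    exists2 c, ucycle E c & size (flatten P) <= size c.
  move=> pJ uJ JR; exists ((x :: p) ++ J).
    rewrite /ucycle cat_uniq up uJ andbT /= rcons_cat cat_path px pJ /=.
    by apply/hasPn=> y /JR yR; apply: contraL yR => /pR.
  by apply: leq_trans sz _; rewrite size_cat leq_addr.
move: aA cA; rewrite !inE => /orP[/eqP Ea|/eqP Ea] /orP[/eqP Ec|/eqP Ec].
- by rewrite Ea Ec eqxx in ac.
(* The link may have been found in either direction. *)
- apply: (close (rev I)); rewrite ?rev_uniq //; last first.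
    by move=> y; rewrite mem_rev; apply: IsubR.
  have := rev_sorted E (c :: rcons (rev I) a); rewrite rev_cons rev_rcons revK.
  have Esw : (fun z => E^~ z) =2 E by move=> ? ?; apply: E_sym.
  by rewrite /= pI -Ec -Ea (eq_path Esw) => /esym.
- by apply: (close I); rewrite // -Ea -Ec.
- by rewrite Ea Ec eqxx in ac.
Qed.

End Linking.

(** * Covering by paths along layers *)

Section Layers.
Variables (V : finType) (E : rel V) (lab : V -> nat) (k : nat).

Definition layer (t : nat) : {set V} := [set v | lab v == t].

(** Besides the edges between consecutive layers, every vertex outside layer 0
    may be matched to itself, which means that it is left out. The loops make
    up for degrees that are smaller than elsewhere. *)
Definition step (v u : V) : bool :=
  (0 < lab v) && (v == u) || E v u && (lab u == (lab v).+1).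

(** A matching of the layers to their successors, followed from layer 0, breaks
    only at unmatched vertices; a loop is never met, as its vertex would have
    two predecessors. *)
Lemma layered_paths (def : nat) : 1 < k ->
    (forall S : {set V}, S \subset [set v | lab v < k.-1] ->
       #|S| <= #|rel_image step S| + def) ->
  exists P : seq (seq V),
    [/\ all (good_path E (layer 0 :|: layer k.-1)) P, uniq (flatten P),
        forall p, p \in P -> size p = k,
        {subset flatten P <= [set v | lab v < k]}
      & #|layer 0| <= size P + def].
Proof.
move=> k1 hallS.
have [L00|[u0 _]] := set_0Vmem (layer 0).
  by exists [::]; split=> //; rewrite L00 cards0.
have [A' [s [A'A cA' hs inj_s]]] := hall_deficiency u0 hallS.
pose alive v j := forall i, i < j -> iter i s v \in A'.
have walk v j : v \in layer 0 -> alive v j ->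
    (forall i, i <= j -> lab (iter i s v) = i) /\
    (forall i, i < j -> E (iter i s v) (iter i.+1 s v)).
  move=> v0; elim: j => [|j IH] al.
    by split=> // -[|//] _; move: v0; rewrite inE => /eqP.
  have [labs Es] : _ /\ _ := IH (fun i ij => al i (ltnW ij)).
  have [Ej labj] : E (iter j s v) (iter j.+1 s v) /\ lab (iter j.+1 s v) = j.+1.
    have /hs := al j (leqnn _); rewrite -iterS /step labs //.
    case/orP=> [/andP[j0 /eqP eqj]|/andP[-> /eqP ->] //].
    have eqjj : iter j s v = iter j.-1 s v.
      by apply: inj_s; rewrite ?al ?prednK -?iterS ?prednK //; apply: leqW.
    by have := labs j.-1 (leq_pred _); rewrite -eqjj labs //; lia.
  split=> i; rewrite ?ltnS leq_eqVlt => /orP[/eqP->|] //.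
    by rewrite ltnS; apply: labs.
  exact: Es.
have inj_iter v v' j : alive v j -> alive v' j -> iter j s v = iter j s v' -> v = v'.
  elim: j => // j IH al al' /inj_s eqj.
  apply: IH; first by move=> i ij; apply: al; apply: ltnW.
    by move=> i ij; apply: al'; apply: ltnW.
  by apply: eqj; [apply: al|apply: al'].
pose full := [set v in layer 0 | [forall i : 'I_k.-1, iter i s v \in A']].
have fullP v : v \in full -> v \in layer 0 /\ alive v k.-1.
  rewrite inE => /andP[v0 /forallP al]; split=> // i ik.
  exact: (al (Ordinal ik)).
(* A path that breaks ends at an unmatched vertex, and different paths end at
   different vertices. *)
have bad_def : #|layer 0 :\: full| <= def.
  have cAA : #|[set v | lab v < k.-1] :\: A'| <= def.
    by rewrite cardsD (setIidPr A'A) leq_subLR.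
  apply: leq_trans cAA.
  have badP v : v \in layer 0 :\: full ->
      exists j, [/\ j < k.-1, alive v j & iter j s v \notin A'].
    rewrite in_setD => /andP[vf v0]; move: vf; rewrite inE v0 /= negb_forall.
    move=> /existsP[i ni].
    have ex : exists i, iter i s v \notin A' by exists i.
    case: (ex_minnP ex) => j nj minj; exists j; split=> //.
      by apply: leq_ltn_trans (minj _ ni) (ltn_ord i).
    move=> i' i'j; apply/negPn/negP => /minj; by rewrite leqNgt i'j.
  pose J v := if [pick j : 'I_k.-1 | (iter j s v \notin A') &&
    [forall i : 'I_j, iter i s v \in A']] is Some j then val j else 0.
  have JP v : v \in layer 0 :\: full ->
      [/\ J v < k.-1, alive v (J v) & iter (J v) s v \notin A'].
    move=> /badP[j [jk alj nj]]; rewrite /J; case: pickP => [j'|/(_ (Ordinal jk))].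
      move=> /andP[nj' /forallP al']; split; [exact: ltn_ord| |exact: nj'].
      by move=> i ij; apply: (al' (Ordinal ij)).
    rewrite /= nj => /negbT; rewrite negb_forall => /existsP[i].
    by rewrite alj.
  rewrite -(@card_in_imset _ _ (fun v => iter (J v) s v)); last first.
    move=> v v' vb v'b eqJ; have [_ al _] := JP v vb; have [_ al' _] := JP v' v'b.
    have v0 : v \in layer 0 by move: vb; rewrite in_setD => /andP[].
    have v'0 : v' \in layer 0 by move: v'b; rewrite in_setD => /andP[].
    have [labs _] := walk v _ v0 al; have [labs' _] := walk v' _ v'0 al'.
    have JJ : J v = J v' by rewrite -[LHS]labs // -[RHS]labs' // eqJ.
    by rewrite -JJ in al' eqJ; apply: inj_iter al al' eqJ.
  apply/subset_leq_card/subsetP=> x /imsetP[v vb ->]; have [Jk al nJ] := JP v vb.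
  have v0 : v \in layer 0 by move: vb; rewrite in_setD => /andP[].
  have [labs _] := walk v _ v0 al.
  by rewrite in_setD nJ inE labs.
pose P := [seq [seq iter j s v | j <- iota 0 k] | v <- enum full].
have inP x : x \in flatten P -> exists v j, [/\ v \in full, j < k & x = iter j s v].
  move=> /flatten_mapP[v]; rewrite mem_enum => vf /mapP[j].
  by rewrite mem_iota add0n => /andP[_ jk] ->; exists v, j.
have kS j : j < k -> j <= k.-1 by lia.
exists P; split.
- apply/allP=> p /mapP[v]; rewrite mem_enum => /fullP[v0 al] ->.
  have [labs Es] := walk v _ v0 al.
  have lastk : last v [seq iter j s v | j <- iota 1 k.-1] = iter k.-1 s v.
    rewrite (last_map (fun j => iter j s v) _ 0); congr (iter _ s v).
    by case: (k.-1) => // k'; rewrite -[k'.+1]addn1 iotaD last_cat /= add1n addn1.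
  have -> : [seq iter j s v | j <- iota 0 k] =
      v :: [seq iter j s v | j <- iota 1 k.-1] by case: (k) k1.
  rewrite /good_path lastk !in_setU v0 orTb [_ \in layer k.-1]inE labs // eqxx.
  rewrite orbT !andTb -size_eq0 size_map size_iota -lt0n kS // andbT.
  apply/(pathP v) => i; rewrite size_map size_iota => ik.
  rewrite (nth_map 0) ?size_iota // nth_iota // add1n.
  case: i ik => [|i] ik /=; first exact: (Es 0).
  rewrite (nth_map 0) ?size_iota; last exact: ltnW.
  by rewrite nth_iota ?add1n; [apply: (Es i.+1)|apply: ltnW].
- apply: (allpairs_uniq (f := fun v j => iter j s v)).
  + exact: enum_uniq.
  + exact: iota_uniq.
  + move=> [v i] [v' i'] /allpairsP[[v1 i1] /= [+ + [-> ->]]].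
    rewrite mem_enum mem_iota add0n => /fullP[v0 al] /andP[_ i1k].
    move=> /allpairsP[[v2 i2] /= [+ + [-> ->]]].
    rewrite mem_enum mem_iota add0n => /fullP[v0' al'] /andP[_ i2k] /= eqi.
    have [labs _] := walk _ _ v0 al; have [labs' _] := walk _ _ v0' al'.
    have ii : i1 = i2 by rewrite -(labs i1) ?kS // eqi labs' ?kS.
    rewrite -ii in eqi *; congr pair; apply: inj_iter eqi.
      by move=> j ji; apply: al; apply: leq_trans ji (kS _ i1k).
    by move=> j ji; apply: al'; apply: leq_trans ji (kS _ i1k).
- by move=> p /mapP[v _ ->]; rewrite size_map size_iota.
- move=> x /inP[v [j [/fullP[v0 al] jk ->]]].
  by have [labs _] := walk _ _ v0 al; rewrite inE labs ?kS.
- rewrite size_map -cardE -(cardsID full (layer 0)) leq_add //.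
  exact: subset_leq_card (subsetIr _ _).
Qed.

Definition outdeg (v : V) : nat := #|nbhd E v :&: layer (lab v).+1|.
Definition indeg (v : V) : nat := #|nbhd E v :&: layer (lab v).-1|.

(** Give each edge between consecutive layers the weight [1 / D] and fill up by
    loops, so that all loads are at most 1. Outside layer 0 only the excess of
    the in-degree over the out-degree is missing. This is a difference of
    random variables with the same mean, however irregular the degrees are. *)
Lemma layered_hall (D def : nat) : symmetric E -> 0 < D ->
    (forall v, 0 < lab v -> indeg v <= D) ->
    (forall v, lab v < k.-1 -> outdeg v <= D) ->
    \sum_(v | lab v < k.-1) (if lab v == 0 then D - outdeg v
                             else indeg v - outdeg v) <= D * def ->
  forall S : {set V}, S \subset [set v | lab v < k.-1] ->
    #|S| <= #|rel_image step S| + def.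
Proof.
move=> E_sym D0 inD outD defD S /subsetP SA.
pose loop v := if lab v == 0 then 0 else D - maxn (indeg v) (outdeg v).
have row : D * #|S| <= \sum_(v in S) (outdeg v + loop v) + D * def.
  apply: leq_trans (leq_add (leqnn _) defD).
  rewrite mulnC -sum_nat_const (bigID [in S] (fun v => lab v < k.-1)) /= addnA.
  apply: leq_trans (leq_addr _ _).
  have -> : \sum_(v | (lab v < k.-1) && (v \in S)) (if lab v == 0 then D - outdeg v
      else indeg v - outdeg v) = \sum_(v in S) (if lab v == 0 then D - outdeg v
      else indeg v - outdeg v).
    apply: eq_bigl => v; case vS: (v \in S); rewrite ?andbF // andbT.
    by have := SA v vS; rewrite inE.
  rewrite -big_split /=; apply: leq_sum => v vS; rewrite /loop.
  have := SA v vS; rewrite inE => /outD; case: eqP => [|/eqP]; first by lia.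
  by rewrite -lt0n => /inD; lia.
have col : \sum_(v in S) (outdeg v + loop v) <= D * #|rel_image step S|.
  have out_sum v : v \in S ->
      outdeg v = \sum_(u in rel_image step S) (E v u && (lab u == (lab v).+1)).
    move=> vS; rewrite /outdeg -sum1_card [RHS]big_mkcond [LHS]big_mkcond /=.
    apply: eq_bigr => u _; rewrite in_setI in_nbhd inE.
    case vu: (E v u && _); last by case: ifP.
    by rewrite (@mem_rel_image _ _ _ _ v) // /step vu orbT.
  have loop_sum : \sum_(v in S) loop v = \sum_(u in rel_image step S) (u \in S) * loop u.
    rewrite [RHS]big_mkcond [LHS]big_mkcond /=; apply: eq_bigr => u _.
    case uS: (u \in S); last by case: ifP.
    rewrite mul1n /loop; case: eqP => [_|/eqP u0]; first by case: ifP.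
    by rewrite (@mem_rel_image _ _ _ _ u) // /step lt0n u0 eqxx.
  rewrite big_split /= loop_sum (eq_bigr _ out_sum) exchange_big /= -big_split /=.
  rewrite mulnC -sum_nat_const; apply: leq_sum => u _.
  have in_sum : \sum_(v in S) (E v u && (lab u == (lab v).+1)) <=
      if lab u == 0 then 0 else indeg u.
    case: eqP => [u0|/eqP u0].
      by rewrite big1 // => v _; rewrite u0 andbF.
    rewrite /indeg -sum1_card [X in X <= _]big_mkcond [X in _ <= X]big_mkcond /=.
    apply: leq_sum => v _; rewrite in_setI in_nbhd inE E_sym.
    case: ifP => // _; case: (E u v) => //=; case: eqP => // ->.
    by rewrite eqxx.
  apply: leq_trans (leq_add in_sum (leqnn _)) _; rewrite /loop.
  case: eqP => [_|/eqP]; first by rewrite muln0.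
  by rewrite -lt0n => /inD; case: (u \in S); lia.
rewrite -(leq_pmul2l D0) mulnDr; apply: leq_trans row _.
by rewrite leq_add2r.
Qed.
End Layers.

Local Open Scope ring_scope.

(** * Uniformly random labellings *)

Section Labellings.
Variables (R : realFieldType) (V : finType) (N : nat).
Hypothesis N_gt0 : (0 < N)%N.
Notation labelling := {ffun V -> 'I_N}.
Implicit Types (f : labelling) (G : labelling -> R).

Definition relabel f (v : V) (a : 'I_N) : labelling :=
  [ffun w => if w == v then a else f w].

Definition ignores G (v : V) : Prop := forall f a, G (relabel f v a) = G f.

(** Swapping the label of [v] with an independent one preserves the uniform
    measure on pairs (labelling, label). *)
Lemma sum_ignoring G (h : 'I_N -> R) v : ignores G v ->
  N%:R * \sum_f G f * h (f v) = (\sum_a h a) * \sum_f G f.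
Proof.
move=> Gv; pose swap (p : labelling * 'I_N) := (relabel p.1 v p.2, p.1 v).
have swapK : involutive swap.
  move=> [f a]; congr pair; last by rewrite ffunE eqxx.
  by apply/ffunP=> w; rewrite !ffunE; case: eqP => [->|].
have -> : N%:R * (\sum_f G f * h (f v)) = \sum_f \sum_(a : 'I_N) G f * h (f v).
  rewrite mulr_sumr; apply: eq_bigr => f _.
  by rewrite sumr_const card_ord mulr_natl.
rewrite pair_bigA (reindex_inj (inv_inj swapK)) /=.
rewrite mulrC mulr_suml; under [RHS]eq_bigr do rewrite mulr_sumr.
rewrite [RHS]pair_bigA; apply: eq_bigr => -[f a] _ /=.
by rewrite Gv ffunE eqxx.
Qed.

(** Events with disjoint supports are independent; this is expressed by the
    generating function of the number of those that occur, which is all that the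
    tail bounds use. *)
Lemma generating_function (I : eqType) (s : seq I) (ev : I -> labelling -> bool)
    (supp : I -> seq V) (rho x : R) :
    (forall i v f a, i \in s -> v \notin supp i -> ev i (relabel f v a) = ev i f) ->
    (forall i G, i \in s -> {in supp i, forall v, ignores G v} ->
       \sum_f G f * (ev i f)%:R = rho * \sum_f G f) ->
    uniq (flatten (map supp s)) ->
  \sum_f x ^+ (count (ev^~ f) s) =
    (1 + (x - 1) * rho) ^+ size s * #|{: labelling}|%:R.
Proof.
elim: s => [|i s IH] local indep; first by rewrite sumr_const expr0 mul1r.
rewrite [flatten _]/= cat_uniq => /and3P[_ /hasPn dis us].
have sub j : j \in s -> j \in i :: s by move=> js; rewrite inE js orbT.
have IHs := IH (fun j v f a js => local j v f a (sub j js))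
  (fun j G js => indep j G (sub j js)) us.
pose G f : R := x ^+ count (ev^~ f) s.
have Gi : {in supp i, forall v, ignores G v}.
  move=> v vi f a; rewrite /G; congr (_ ^+ _); apply: eq_in_count => j js.
  apply: local; first exact: sub.
  apply: contraL vi => vj; apply: dis.
  by apply/flatten_mapP; exists j.
have -> : \sum_f x ^+ count (ev^~ f) (i :: s) =
    \sum_f G f + (x - 1) * (\sum_f G f * (ev i f)%:R).
  rewrite mulr_sumr -big_split /=; apply: eq_bigr => f _; rewrite /G /=.
  by case: (ev i f); rewrite ?add1n ?add0n ?exprS /=; ring.
rewrite indep ?mem_head // IHs /= exprS; ring.
Qed.

Lemma count_enum (X : {set V}) (P : pred V) :
  count P (enum X) = #|[set v in X | P v]|.
Proof.
rewrite -size_filter cardE; apply/perm_size/uniq_perm => [||v];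
  [exact/filter_uniq/enum_uniq|exact: enum_uniq|].
by rewrite mem_filter !mem_enum inE andbC.
Qed.

Lemma single_generating (X : {set V}) (a : 'I_N) (x : R) :
  \sum_(f : labelling) x ^+ #|X :&: [set v | f v == a]| =
    (1 + (x - 1) * N%:R^-1) ^+ #|X| * #|{: labelling}|%:R.
Proof.
rewrite cardE -(@generating_function _ (enum X) (fun v f => f v == a) (fun v => [:: v])).
- apply: eq_bigr => f _; congr (_ ^+ _); rewrite count_enum.
  by congr #|pred_of_set _|; apply/setP=> v; rewrite !inE.
- move=> v w f b _; rewrite inE => /negPf wv.
  by rewrite ffunE [v == w]eq_sym wv.
- move=> v G _ Gv; have N0 : N%:R != 0 :> R by rewrite pnatr_eq0 -lt0n.
  apply: (mulfI N0); rewrite (@sum_ignoring _ (fun b => (b == a)%:R)) ?mulVKf //.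
    by rewrite (bigD1 a) //= eqxx big1 ?addr0 ?mul1r // => b /negPf ->.
  by apply: Gv; rewrite inE.
- by rewrite flatten_seq1; apply: enum_uniq.
Qed.

(** The pairs [(v, g v)] are disjoint, so they survive in a class
    independently. *)
Lemma pair_generating (X : {set V}) (g : V -> V) (a : 'I_N) (x : R) :
    {in X &, injective g} -> (forall v, v \in X -> g v \notin X) ->
  \sum_(f : labelling) x ^+ #|[set v in X | (f v == a) && (f (g v) == a)]| =
    (1 + (x - 1) * (N%:R^-1 * N%:R^-1)) ^+ #|X| * #|{: labelling}|%:R.
Proof.
move=> ginj gX.
rewrite cardE -(@generating_function _ (enum X)
  (fun v f => (f v == a) && (f (g v) == a)) (fun v => [:: v; g v])).
- by apply: eq_bigr => f _; rewrite count_enum.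
- move=> v w f b _; rewrite !inE negb_or => /andP[wv wg].
  by rewrite !ffunE [v == w]eq_sym (negPf wv) [g v == w]eq_sym (negPf wg).
- move=> v G; rewrite mem_enum => vX Gv.
  have N0 : N%:R != 0 :> R by rewrite pnatr_eq0 -lt0n.
  have one : \sum_(b : 'I_N) (b == a)%:R = 1 :> R.
    by rewrite (bigD1 a) //= eqxx big1 ?addr0 // => b /negPf -> .
  have vg : v != g v by apply: contraNneq (gX v vX) => <-.
  pose G' f := G f * (f v == a)%:R.
  have G'g : ignores G' (g v).
    by move=> f b; rewrite /G' Gv ?inE ?eqxx ?orbT // ffunE (negPf vg).
  apply: (mulfI N0); transitivity (N%:R * \sum_f G' f * (f (g v) == a)%:R).
    by congr (_ * _); apply: eq_bigr => f _; rewrite -mulrA -natrM mulnb.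
  rewrite (@sum_ignoring _ (fun b => (b == a)%:R)) // one mul1r.
  apply: (mulfI N0); rewrite (@sum_ignoring _ (fun b => (b == a)%:R)); last first.
    by apply: Gv; rewrite inE eqxx.
  by rewrite one mul1r -mulrA !mulVKf.
- have : all [in X] (enum X) by apply/allP=> v; rewrite mem_enum.
  elim: (enum X) (enum_uniq X) => //= v s IH /andP[vs us] /andP[vX sX].
  have inF w : w \in flatten [seq [:: u; g u] | u <- s] ->
      exists2 u, u \in s & (w == u) || (w == g u).
    by move=> /flatten_mapP[u us']; rewrite !inE => wu; exists u.
  rewrite IH // andbT inE negb_or -andbA; apply/and3P; split.
  + by apply: contraNneq (gX v vX) => <-.
  + apply/negP=> /inF[u us' /orP[/eqP vu|/eqP vu]]; first by rewrite vu us' in vs.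
    by have := gX u (allP sX u us'); rewrite -vu vX.
  + apply/negP=> /inF[u us' /orP[/eqP gu|/eqP gu]].
      by have := gX v vX; rewrite gu (allP sX u us').
    by move: vs; rewrite (ginj v u vX (allP sX u us') gu) us'.
Qed.

Section SecondMoment.
Variables (E : rel V) (mid : pred 'I_N).
Hypothesis E_irr : irreflexive E.
Hypothesis mid_inner : forall t : 'I_N, mid t -> (0 < t)%N /\ (t.+1 < N)%N.

(** What a neighbour with label [a] contributes to the in-degree minus the
    out-degree of a vertex with label [t]. *)
Definition drift (a t : 'I_N) : R := (a.+1 == t :> nat)%:R - (a == t.+1 :> nat)%:R.

Definition imbalance f (v : V) : R := \sum_(u in nbhd E v) drift (f u) (f v).

Lemma drift_sum t : mid t -> \sum_a drift a t = 0 /\ \sum_a drift a t ^+ 2 = 2%:R.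
Proof.
move=> /mid_inner[t0 tN].
have pN : (t.-1 < N)%N by apply: leq_ltn_trans (leq_pred _) (ltn_ord t).
have ind (i : 'I_N) : \sum_(a : 'I_N) (a == i)%:R = 1 :> R.
  by rewrite (bigD1 i) //= eqxx big1 ?addr0 // => a /negPf->.
have low : \sum_(a : 'I_N) (a.+1 == t :> nat)%:R = 1 :> R.
  rewrite -[RHS](ind (Ordinal pN)); apply: eq_bigr => a _.
  suff -> : (a == Ordinal pN) = (a.+1 == t :> nat) by [].
  by rewrite -val_eqE /= -eqSS prednK.
have high : \sum_(a : 'I_N) (a == t.+1 :> nat)%:R = 1 :> R.
  exact: (ind (Ordinal tN)).
split; first by rewrite big_split sumrN /= low high subrr.
have -> : 2%:R = 1 + 1 :> R by ring.
transitivity (\sum_(a : 'I_N) ((a.+1 == t :> nat)%:R + (a == t.+1 :> nat)%:R) : R);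
  last by rewrite big_split /= low high.
apply: eq_bigr => a _ /=; rewrite /drift.
have [e1|] := eqVneq a.+1 t; have [e2|] := eqVneq (a : nat) t.+1 => //=;
  first (by exfalso; lia); by intros; ring.
Qed.

(** Distinct neighbours of [v] contribute uncorrelated, centred drifts. *)
Lemma second_moment v :
  \sum_(f : labelling) (mid (f v))%:R * imbalance f v ^+ 2 <=
    2%:R * #|nbhd E v|%:R / N%:R * #|{: labelling}|%:R.
Proof.
have N0 : N%:R != 0 :> R by rewrite pnatr_eq0 -lt0n.
have nv u : u \in nbhd E v -> v != u.
  by rewrite in_nbhd; apply: contraTneq => ->; rewrite E_irr.
(* at_ t freezes the label of v, so that only neighbours remain random. *)
pose at_ t f : R := (mid t && (f v == t))%:R.
have at_u u t : v != u -> ignores (at_ t) u.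
  by move=> vu f a; rewrite /at_ ffunE (negPf vu).
have split_t f (F : 'I_N -> R) : (mid (f v))%:R * F (f v) = \sum_t at_ t f * F t.
  rewrite (bigD1 (f v)) //= /at_ eqxx andbT big1 ?addr0 // => t tf.
  by rewrite [f v == t]eq_sym (negPf tf) andbF mul0r.
have cross u u' : u \in nbhd E v -> u' \in nbhd E v -> u' != u ->
    \sum_(f : labelling) (mid (f v))%:R * (drift (f u) (f v) * drift (f u') (f v)) = 0.
  move=> uv u'v uu.
  under eq_bigr do rewrite (split_t _ (fun t => drift (_ u) t * drift (_ u') t)).
  rewrite exchange_big /= big1 // => t _; case: (boolP (mid t)) => mt; last first.
    by apply: big1 => f _; rewrite /at_ (negPf mt) mul0r.
  apply: (mulfI N0); rewrite mulr0.
  under eq_bigr do rewrite [drift (_ u) t * _]mulrC mulrA.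
  rewrite (@sum_ignoring (fun f => at_ t f * drift (f u') t) (fun a => drift a t)).
    by have [-> _] := drift_sum mt; rewrite mul0r.
  by move=> f a; rewrite at_u ?nv // ffunE (negPf uu).
have diag u : u \in nbhd E v ->
    \sum_(f : labelling) (mid (f v))%:R * (drift (f u) (f v) * drift (f u) (f v)) <=
    2%:R / N%:R * #|{: labelling}|%:R.
  move=> uv; under eq_bigr do rewrite (split_t _ (fun t => drift (_ u) t * drift (_ u) t)).
  rewrite exchange_big /=.
  have -> : #|{: labelling}|%:R = \sum_(t : 'I_N) \sum_(f : labelling) (f v == t)%:R :> R.
    rewrite exchange_big /= -[LHS]sumr_const; apply: eq_bigr => f _.
    by rewrite (bigD1 (f v)) //= eqxx big1 ?addr0 // => t; rewrite eq_sym => /negPf->.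
  rewrite mulr_sumr; apply: ler_sum => t _; case: (boolP (mid t)) => mt; last first.
    rewrite big1; last by move=> f _; rewrite /at_ (negPf mt) mul0r.
    by rewrite mulr_ge0 ?divr_ge0 ?sumr_ge0 // => ? _.
  have <- : \sum_f at_ t f = \sum_(f : labelling) (f v == t)%:R.
    by apply: eq_bigr => f _; rewrite /at_ mt.
  rewrite le_eqVlt; apply/orP; left; apply/eqP/(mulfI N0).
  rewrite (@sum_ignoring (at_ t) (fun a => drift a t * drift a t)); last exact: at_u (nv _ uv).
  under eq_bigr do rewrite -expr2.
  by have [_ ->] := drift_sum mt; rewrite mulrA mulrCA divff ?mulr1.
have -> : \sum_(f : labelling) (mid (f v))%:R * imbalance f v ^+ 2 =
  \sum_(u in nbhd E v) \sum_(u' in nbhd E v) \sum_(f : labelling)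
    (mid (f v))%:R * (drift (f u) (f v) * drift (f u') (f v)).
  under [RHS]eq_bigr do rewrite exchange_big /=.
  rewrite [RHS]exchange_big /=; apply: eq_bigr => f _.
  rewrite expr2 {1}/imbalance mulr_suml mulr_sumr; apply: eq_bigr => u _.
  by rewrite /imbalance !mulr_sumr.
apply: (@le_trans _ _ (\sum_(u in nbhd E v) 2%:R / N%:R * #|{: labelling}|%:R)).
  apply: ler_sum => u uv; rewrite (bigD1 u) //= [X in _ + X]big1 ?addr0 ?diag //.
  by move=> u' /andP[u'v uu]; apply: cross.
by rewrite sumr_const -mulr_natl le_eqVlt; apply/orP; left; apply/eqP; ring.
Qed.

End SecondMoment.

End Labellings.

(** * Chernoff bounds *)

Section Chernoff.
Variables (R : realType) (T : finType) (cnt : T -> nat) (rho : R) (mu : nat).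
Hypothesis gf : forall x : R,
  \sum_t x ^+ cnt t = (1 + (x - 1) * rho) ^+ mu * #|T|%:R.
Hypothesis rho01 : 0 <= rho <= 1.

Lemma markov_count (P : pred T) (x c : R) : 0 <= x ->
  (forall t, P t -> c <= x ^+ cnt t) ->
  c * #|[set t | P t]|%:R <= (1 + (x - 1) * rho) ^+ mu * #|T|%:R.
Proof.
move=> x0 Pc; rewrite -gf mulr_natr -sumr_const.
rewrite big_mkcond [X in _ <= X]big_mkcond /=; apply: ler_sum => t _.
by rewrite inE; case: ifP => [/Pc//|_]; apply: exprn_ge0.
Qed.

Lemma expR_exprn_ge (y : R) n : 0 <= 1 + y -> (1 + y) ^+ n <= expR (y * n%:R).
Proof. by move=> y0; rewrite expRM_natr lerXn2r ?nnegrE ?expR_ge0 // expR_ge1Dx. Qed.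

(** The exponential moment at [1 + gam / 4], which is not optimal but needs only
    elementary bounds for the exponential. *)
Lemma upper_tail (gam M : R) : 0 < gam <= 1 -> 0 <= M -> rho * mu%:R <= M ->
  #|[set t | (1 + gam) * M <= (cnt t)%:R]|%:R <=
    expR (- (gam ^+ 2 / 8%:R * M)) * #|T|%:R.
Proof.
move=> /andP[g0 g1] M0 hM; pose y := gam / 4%:R.
have y0 : 0 < y by rewrite divr_gt0.
have y1 : y <= 4%:R^-1 by rewrite /y; lra.
have base : expR (y - y ^+ 2) <= 1 + y.
  have h : 0 < 1 - (y - y ^+ 2) by nra.
  apply: (@le_trans _ _ (1 - (y - y ^+ 2))^-1).
    rewrite -[leLHS]invrK -expRN lef_pV2 ?posrE ?expR_gt0 //.
    by apply: le_trans (expR_ge1Dx _); lra.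
  by rewrite -[leRHS]invrK lef_pV2 ?posrE ?invr_gt0 //; [|lra];
     rewrite -div1r ler_pdivrMr; [nra|lra].
have c0 := expR_gt0 ((y - y ^+ 2) * ((1 + gam) * M)).
rewrite -(ler_pM2l c0) [leRHS]mulrA -expRD.
apply: le_trans (@markov_count _ (1 + y) _ _ _) _.
- by lra.
- move=> t ht; apply: (@le_trans _ _ (expR ((y - y ^+ 2) * (cnt t)%:R))).
    by rewrite ler_expR ler_wpM2l //; nra.
  by rewrite expRM_natr lerXn2r ?nnegrE ?expR_ge0 //; lra.
- rewrite addrAC subrr add0r ler_wpM2r //; case/andP: rho01 => r0 r1.
  apply: le_trans (expR_exprn_ge _ _) _; first by nra.
  rewrite ler_expR -mulrA; apply: (@le_trans _ _ (y * M)).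
    by rewrite ler_wpM2l // ltW.
  rewrite mulrA -mulrBl ler_wpM2r //; rewrite /y in y0 y1 *; nra.
Qed.

Lemma lower_tail (gam M : R) : 0 < gam <= 1 -> 0 <= M -> M <= rho * mu%:R ->
  #|[set t | (cnt t)%:R <= (1 - gam) * M]|%:R <=
    expR (- (gam ^+ 2 / 8%:R * M)) * #|T|%:R.
Proof.
move=> /andP[g0 g1] M0 hM; pose y := gam / 4%:R.
have y0 : 0 < y by rewrite divr_gt0.
have y1 : y <= 4%:R^-1 by rewrite /y; lra.
have base : expR (- (y + 2%:R * y ^+ 2)) <= 1 - y.
  have h : 0 < 1 + (y + 2%:R * y ^+ 2) by nra.
  apply: (@le_trans _ _ (1 + (y + 2%:R * y ^+ 2))^-1).
    by rewrite expRN lef_pV2 ?posrE ?expR_gt0 // expR_ge1Dx.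
  by rewrite -div1r ler_pdivrMr //; nra.
have c0 := expR_gt0 (- (y + 2%:R * y ^+ 2) * ((1 - gam) * M)).
rewrite -(ler_pM2l c0) [leRHS]mulrA -expRD.
apply: le_trans (@markov_count _ (1 - y) _ _ _) _.
- by lra.
- move=> t ht; apply: (@le_trans _ _ (expR (- (y + 2%:R * y ^+ 2) * (cnt t)%:R))).
    by rewrite ler_expR ler_wnM2l //; nra.
  by rewrite expRM_natr lerXn2r ?nnegrE ?expR_ge0 //; lra.
- rewrite addrAC subrr add0r ler_wpM2r //; case/andP: rho01 => r0 r1.
  apply: le_trans (expR_exprn_ge _ _) _; first by nra.
  rewrite ler_expR -mulrA; apply: (@le_trans _ _ (- y * M)).
    by rewrite !mulNr lerN2 ler_wpM2l // ltW.
  rewrite mulrA.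
  have -> : - (y + 2%:R * y ^+ 2) * (1 - gam) * M - gam ^+ 2 / 8%:R * M =
    (- (y + 2%:R * y ^+ 2) * (1 - gam) - gam ^+ 2 / 8%:R) * M by ring.
  by rewrite ler_wpM2r //; rewrite /y in y0 y1 *; nra.
Qed.

End Chernoff.

(** * Matchings across the cuts of an expander *)

Section ExpanderMatching.
Variables (R : realType) (V : finType) (E : rel V) (lam : R).
Hypothesis E_sym : symmetric E.
Hypothesis expE : expander E lam.
Hypothesis lam02 : 0 <= lam <= 2%:R.

(** The end vertices of a maximal matching across a cut contain the outer
    boundary of what the matching leaves of either side. Applied to the side with
    at most half of the vertices, expansion bounds the matching from below. *)
Lemma cut_matching (Y : {set V}) (x : R) : x <= #|Y|%:R -> x <= #|~: Y|%:R ->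
  exists (Y0 : {set V}) (g : V -> V),
    [/\ Y0 \subset Y, {in Y0 &, injective g},
        forall y, y \in Y0 -> g y \notin Y /\ E y (g y)
      & lam * x <= 4%:R * #|Y0|%:R].
Proof.
move=> xY xYC.
pose P (M : {set V * V}) :=
  [forall p in M, [&& p.1 \in Y, p.2 \notin Y & E p.1 p.2]] &&
  [forall p in M, forall q in M, (p.1 == q.1) || (p.2 == q.2) ==> (p == q)].
have P0 : P set0.
  by apply/andP; split; apply/forall_inP => p; rewrite inE.
case: (arg_maxnP (fun M : {set V * V} => #|M|) P0) => M /andP[/forall_inP inM /forall_inP disM] maxM.
have eqM p q : p \in M -> q \in M -> (p.1 == q.1) || (p.2 == q.2) -> p = q.
  by move=> pM qM h; have /forall_inP/(_ q qM) := disM p pM; rewrite h => /eqP.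
pose Y0 : {set V} := [set p.1 | p in M]; pose Z0 : {set V} := [set p.2 | p in M].
have cY0 : #|Y0| = #|M|.
  by rewrite card_in_imset // => p q pM qM h; apply: eqM; rewrite // h eqxx.
have cZ0 : #|Z0| = #|M|.
  by rewrite card_in_imset // => p q pM qM h; apply: eqM; rewrite // h eqxx orbT.
have extend y u : y \in Y -> u \notin Y -> E y u -> (y \in Y0) || (u \in Z0).
  move=> yY uY yu; apply/negPn/negP; rewrite negb_or => /andP[yY0 uZ0].
  have yuM : (y, u) \notin M by apply: contra yY0 => h; apply/imsetP; exists (y, u).
  have apart p : p \in M -> (p.1 != y) && (p.2 != u).
    move=> pM; apply/andP; split.
      by apply: contraNneq yY0 => <-; apply: imset_f.
    by apply: contraNneq uZ0 => <-; apply: imset_f.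
  suff /maxM : P ((y, u) |: M) by rewrite /= cardsU1 yuM add1n ltnn.
  apply/andP; split; apply/forall_inP => p; rewrite in_setU1 => /predU1P[->|pM] /=.
  - by rewrite yY uY yu.
  - exact: inM.
  - apply/forall_inP => q; rewrite in_setU1 => /predU1P[->|qM] /=.
      by rewrite !eqxx.
    by have /andP[/negPf h1 /negPf h2] := apart q qM; rewrite eq_sym h1 eq_sym h2.
  - apply/forall_inP => q; rewrite in_setU1 => /predU1P[->|qM] /=.
      by have /andP[/negPf h1 /negPf h2] := apart p pM; rewrite h1 h2.
    by apply/implyP => h; apply/eqP/eqM.
pose g y := odflt y [pick u | (y, u) \in M].
have gM y : y \in Y0 -> (y, g y) \in M.
  move=> /imsetP[p pM ->]; rewrite /g; case: pickP => //= /(_ p.2).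
  by rewrite -surjective_pairing pM.
have Y0Y : Y0 \subset Y by apply/subsetP=> y /gM /inM /and3P[].
have Z0Y : Z0 \subset ~: Y.
  by apply/subsetP=> u /imsetP[p /inM /and3P[_ pY _] ->]; rewrite inE.
exists Y0, g; split=> //.
- move=> y y' /gM yM /gM y'M gg.
  by have [] : (y, g y) = (y', g y') by apply: eqM; rewrite //= gg eqxx orbT.
- by move=> y /gM /inM /and3P[].
have cC : (#|Y0 :|: Z0| <= 2 * #|M|)%N.
  by apply: leq_trans (card_setU_le _ _) _; rewrite cY0 cZ0; lia.
have side (X : {set V}) (X0 : {set V}) : X0 \subset X -> #|X0| = #|M| ->
    (2 * #|X| <= #|V|)%N -> ext_nbhd E (X :\: X0) \subset Y0 :|: Z0 ->
    lam * #|X|%:R <= 4%:R * #|M|%:R.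
  move=> X0X cX0 half sub.
  have cD : #|X :\: X0|%:R = #|X|%:R - #|M|%:R :> R.
    by rewrite cardsD (setIidPr X0X) natrB -?cX0 ?subset_leq_card.
  have H := @expE (X :\: X0); rewrite cD in H.
  have MX : #|M|%:R <= #|X|%:R :> R by rewrite ler_nat -cX0 subset_leq_card.
  have h2 : 2%:R * #|X|%:R <= #|V|%:R :> R by rewrite -natrM ler_nat.
  have h3 : #|ext_nbhd E (X :\: X0)|%:R <= 2%:R * #|M|%:R :> R.
    by rewrite -natrM ler_nat; apply: leq_trans (subset_leq_card sub) cC.
  have M0 : 0 <= #|M|%:R :> R by [].
  case/andP: lam02 => l0 l2.
  by have /H : #|X|%:R - #|M|%:R <= #|V|%:R / 2 :> R; [lra|nra].
have [half|half] := leqP (2 * #|Y|) #|V|.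
  rewrite cY0; apply: le_trans (side Y Y0 Y0Y cY0 half _).
    by case/andP: lam02 => l0 _; rewrite ler_wpM2l.
  apply/subsetP=> u; rewrite inE => /andP[uD /exists_inP[y]].
  rewrite in_setD => /andP[yY0 yY] yu; rewrite in_setU.
  move: uD; rewrite in_setD negb_and negbK => /orP[->//|uY].
  by have := extend y u yY uY yu; rewrite (negPf yY0) /= => ->; rewrite orbT.
rewrite cY0; apply: le_trans (side (~: Y) Z0 Z0Y cZ0 _ _).
- by case/andP: lam02 => l0 _; rewrite ler_wpM2l.
- by have := cardsC Y; lia.
- apply/subsetP=> u; rewrite inE => /andP[uD /exists_inP[y]].
  rewrite in_setD => /andP[yZ0]; rewrite in_setC => yY yu; rewrite in_setU.
  move: uD; rewrite in_setD negb_and negbK => /orP[->|]; first by rewrite orbT.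
  rewrite in_setC negbK => uY.
  have := extend u y uY yY; rewrite E_sym => /(_ yu).
  by rewrite (negPf yZ0) orbF => ->.
Qed.

End ExpanderMatching.

(** * A labelling with pseudo-random classes *)

Lemma card_bigcup_le (R : realType) (I T : finType) (P : pred I) (F : I -> {set T}) :
  #|\bigcup_(i | P i) F i|%:R <= \sum_(i | P i) #|F i|%:R :> R.
Proof.
apply: (big_ind2 (fun (X : {set T}) (m : R) => #|X|%:R <= m)) => //.
  by rewrite cards0.
move=> X m Y m' hX hY; apply: le_trans (lerD hX hY).
by rewrite -natrD ler_nat card_setU_le.
Qed.

(** The union bound over nonempty sets [A] costs next to nothing if the failure
    probability is at most [x ^+ #|A|] with [x] much smaller than [1 / #|T|]. *)
Lemma sum_nonempty_subsets (R : realType) (T : finType) (x : R) :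
  0 <= x -> #|T|%:R * x <= 1 / 2%:R ->
  \sum_(A : {set T} | A != set0) x ^+ #|A| <= 2%:R * #|T|%:R * x.
Proof.
move=> x0 small.
have tot : \sum_(A : {set T}) x ^+ #|A| = (1 + x) ^+ #|T|.
  rewrite -prodr_const.
  have -> : \prod_(i in T) (1 + x) = \prod_(i : T) (x + 1) by apply: eq_bigr => i _; rewrite addrC.
  rewrite bigA_distr; apply: eq_bigr => A _.
  by rewrite -big_mkcond /= prodr_const.
have {tot} -> : \sum_(A : {set T} | A != set0) x ^+ #|A| = (1 + x) ^+ #|T| - 1.
  by rewrite -tot [X in _ = X - 1](bigD1 set0) //= cards0 expr0 addrAC subrr add0r.
have h1 : (1 + x) ^+ #|T| <= expR (#|T|%:R * x).
  by rewrite mulrC; apply: expR_exprn_ge; lra.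
set y := _ * x in small h1.
have h2 : expR y <= (1 - y)^-1.
  rewrite -[leLHS]invrK -expRN lef_pV2 ?posrE ?expR_gt0 //; last lra.
  by apply: le_trans (expR_ge1Dx _).
have y0 : 0 <= y by rewrite mulr_ge0.
have h3 : (1 - y)^-1 <= 1 + 2%:R * y.
  by rewrite -div1r ler_pdivrMr; [nra|lra].
by rewrite -mulrA -/y; lra.
Qed.

Lemma sum_label (R : realType) (J : finType) (N : nat) (P : pred J) (F : J -> R) :
  \sum_(p : J * 'I_N | P p.1) F p.1 = N%:R * \sum_(j | P j) F j.
Proof.
rewrite (eq_bigl (fun p : J * 'I_N => P p.1 && xpredT p.2)); last first.
  by move=> p; rewrite andbT.
rewrite -(pair_big P xpredT (fun j _ => F j)) /= mulr_sumr.
by apply: eq_bigr => j _; rewrite sumr_const card_ord mulr_natl.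
Qed.

Section RandomLabelling.
Variables (R : realType) (V : finType) (E : rel V) (lam : R).
Hypotheses (E_sym : symmetric E) (E_irr : irreflexive E).
Hypothesis expE : expander E lam.
Hypothesis lam02 : 0 <= lam <= 2%:R.
Variables (N d Delta b : nat).
Hypotheses (N_gt0 : (0 < N)%N) (d_gt0 : (0 < d)%N).
Hypothesis min_deg : forall v, (d <= #|nbhd E v|)%N.
Hypothesis max_deg : forall v, (#|nbhd E v| <= Delta)%N.
(* One numerical constant serves all the largeness conditions. *)
Variables (K L eta : R).
Hypothesis KE : K = 8%:R ^+ 5.
Let n := #|V|.
Hypothesis n_ge4 : (4 <= n)%N.
Hypothesis N_le_n : (N <= n)%N.
Hypothesis n_expL : n%:R <= expR L.
Hypothesis eta01 : 0 < eta <= 1.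
Hypothesis eta_half : eta <= 2%:R^-1.
Hypothesis dN_eta : 4%:R * L <= eta ^+ 2 / 8%:R * (d%:R / N%:R).
Hypothesis b_large : K * L <= b%:R.
Hypothesis dN_large : K * L <= d%:R / N%:R.
Hypothesis lam_d_L : K * (4%:R * L) * N%:R ^+ 2 <= lam * d%:R.
Variable kap : nat.
Hypothesis lam_d_kap : K * kap%:R * N%:R ^+ 2 <= lam * d%:R.

Notation labelling := {ffun V -> 'I_N}.

Definition class (f : labelling) (a : 'I_N) : {set V} := [set v | f v == a].

Let q : R := N%:R^-1.
Let Om : R := #|{: labelling}|%:R.
(* At most n ^ -4: the failure probability allowed per element of a set that a union
   bound ranges over. *)
Let tau : R := expR (- (4%:R * L)).

Let q01 : 0 <= q <= 1.
Proof. by rewrite /q invr_ge0 ler0n /= invf_le1 ?ltr0n // ler1n. Qed.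

Let q_gt0 : 0 < q. Proof. by rewrite invr_gt0 ltr0n. Qed.

Let n_gt0 : 0 < n%:R :> R.
Proof. by rewrite ltr0n; apply: leq_trans n_ge4. Qed.

Let L_gt0 : 0 < L.
Proof.
have : 1 < expR L by apply: lt_le_trans n_expL; rewrite ltr1n; apply: leq_trans n_ge4.
by rewrite -[X in X < _]expR0 ltr_expR.
Qed.

Let Om_ge0 : 0 <= Om. Proof. exact: ler0n. Qed.

Let Om_gt0 : 0 < Om.
Proof. by rewrite ltr0n; apply/card_gt0P; exists [ffun=> Ordinal N_gt0]. Qed.

Lemma class_upper (X : {set V}) a (gam M : R) : 0 < gam <= 1 -> 0 <= M ->
  q * #|X|%:R <= M ->
  #|[set f | (1 + gam) * M <= #|X :&: class f a|%:R]|%:R <=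
    expR (- (gam ^+ 2 / 8%:R * M)) * Om.
Proof.
move=> g01 M0 hM; apply: (upper_tail (rho := q) (mu := #|X|)) => // x.
exact: single_generating.
Qed.

Lemma class_lower (X : {set V}) a (gam M : R) : 0 < gam <= 1 -> 0 <= M ->
  M <= q * #|X|%:R ->
  #|[set f | #|X :&: class f a|%:R <= (1 - gam) * M]|%:R <=
    expR (- (gam ^+ 2 / 8%:R * M)) * Om.
Proof.
move=> g01 M0 hM; apply: (lower_tail (rho := q) (mu := #|X|)) => // x.
exact: single_generating.
Qed.

Lemma pair_lower (X : {set V}) (g : V -> V) a (M : R) :
    {in X &, injective g} -> (forall v, v \in X -> g v \notin X) -> 0 <= M ->
    M <= q * q * #|X|%:R ->
  #|[set f : labelling | #|[set v in X | (f v == a) && (f (g v) == a)]|%:R <=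
      (1 - 2%:R^-1) * M]|%:R <= expR (- (32%:R^-1 * M)) * Om.
Proof.
move=> gi gX M0 hM.
have -> : 32%:R^-1 = 2%:R^-1 ^+ 2 / 8%:R :> R by field.
apply: (lower_tail (rho := q * q) (mu := #|X|)) => //.
- by move=> x; apply: pair_generating.
- by case/andP: q01 => h0 h1; rewrite mulr_ge0 //= mulr_ile1.
- by rewrite invr_gt0 ltr0n invf_le1 ?ltr0n // ler1n.
Qed.

Lemma expR_tau (y : R) k : 4%:R * L * k%:R <= y -> expR (- y) <= tau ^+ k.
Proof. by move=> h; rewrite /tau -expRM_natr ler_expR mulNr lerN2. Qed.

Let tau_ge0 : 0 <= tau. Proof. exact: expR_ge0. Qed.

Let tau_n : tau * n%:R ^+ 4 <= 1.
Proof.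
have : n%:R ^+ 4 <= expR (4%:R * L).
  by rewrite expRM_natl lerXn2r ?nnegrE ?expR_ge0 ?ler0n.
move=> h; rewrite /tau expRN mulrC ler_pdivrMr ?expR_gt0 // mul1r.
by [].
Qed.

Let S1 : R := \sum_(T : {set V} | T != set0) tau ^+ #|T|.

Let S1_le : S1 <= 2%:R * n%:R * tau.
Proof.
apply: sum_nonempty_subsets => //; rewrite -/n.
have n4 : 4%:R <= n%:R :> R by rewrite ler_nat.
have := tau_n; have := tau_ge0; move: tau (n%:R : R) n4 => t x x4 t0 h.
have : 64%:R * (x * t) <= 1.
  apply: le_trans h; have -> : t * x ^+ 4 = x ^+ 3 * (x * t) by ring.
  rewrite ler_wpM2r ?mulr_ge0 //; first by lra.
  by rewrite exprS; nra.
by lra.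
Qed.

Let S1_ge0 : 0 <= S1.
Proof. by apply: sumr_ge0 => T _; apply: exprn_ge0. Qed.

Let bad_high : {set labelling} := \bigcup_(p : V * 'I_N)
  [set f | (1 + eta) * (q * Delta%:R) <= #|nbhd E p.1 :&: class f p.2|%:R].

Let bad_low : {set labelling} := \bigcup_(p : V * 'I_N)
  [set f | #|nbhd E p.1 :&: class f p.2|%:R <= (1 - eta) * (q * d%:R)].

Let dqE : d%:R / N%:R = q * d%:R. Proof. by rewrite mulrC. Qed.

Let dDelta : (d <= Delta)%N.
Proof.
have /card_gt0P[v _] : (0 < #|V|)%N by apply: leq_trans n_ge4.
exact: leq_trans (min_deg v) (max_deg v).
Qed.

Let vertex_label_sum (F : V * 'I_N -> {set labelling}) :
  (forall p, #|F p|%:R <= tau * Om) ->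
  #|\bigcup_p F p|%:R <= n%:R ^+ 2 * tau * Om.
Proof.
move=> hF; apply: le_trans (card_bigcup_le _ _ _) _.
apply: (@le_trans _ _ (\sum_(p : V * 'I_N) tau * Om)); first exact: ler_sum.
rewrite sumr_const card_prod card_ord -/n -[leLHS]mulr_natl natrM expr2 -!mulrA.
rewrite ler_wpM2l // ler_wpM2r ?mulr_ge0 //.
by rewrite ler_nat.
Qed.

Let card_bad_high : #|bad_high|%:R <= n%:R ^+ 2 * tau * Om.
Proof.
apply: vertex_label_sum => p; apply: le_trans (class_upper _ eta01 _ _) _.
- by rewrite mulr_ge0 // ltW.
- by rewrite ler_wpM2l ?ler_nat // ltW.
- rewrite ler_wpM2r // -[leRHS]expr1 expR_tau // mulr1; apply: le_trans dN_eta _.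
  rewrite dqE ler_wpM2l ?divr_ge0 ?sqr_ge0 //.
  by rewrite ler_wpM2l ?ler_nat // ltW.
Qed.

Let card_bad_low : #|bad_low|%:R <= n%:R ^+ 2 * tau * Om.
Proof.
apply: vertex_label_sum => p; apply: le_trans (class_lower _ eta01 _ _) _.
- by rewrite mulr_ge0 // ltW.
- by rewrite ler_wpM2l ?ler_nat // ltW.
- by rewrite ler_wpM2r // -[leRHS]expr1 expR_tau // mulr1 -dqE.
Qed.

Let common (T B : {set V}) := nbhds E T :&: nbhds E B.

Let bad_common : {set labelling} :=
  \bigcup_(p : {set V} * {set V} * 'I_N |
    [&& p.1.1 != set0, p.1.2 != set0 &
      (N * b * (#|p.1.1| + #|p.1.2|) <= #|common p.1.1 p.1.2|)%N])
  [set f | #|common p.1.1 p.1.2 :&: class f p.2|%:R <=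
     (1 - 2%:R^-1) * (q * #|common p.1.1 p.1.2|%:R)].

Let half01 : 0 < (2%:R^-1 : R) <= 1.
Proof. by rewrite invr_gt0 ltr0n invf_le1 ?ltr0n // ler1n. Qed.

Let card_bad_common : #|bad_common|%:R <= n%:R * S1 ^+ 2 * Om.
Proof.
apply: le_trans (card_bigcup_le _ _ _) _.
apply: (@le_trans _ _ (\sum_(p : {set V} * {set V} * 'I_N |
   (p.1.1 != set0) && (p.1.2 != set0)) tau ^+ #|p.1.1| * tau ^+ #|p.1.2| * Om)).
  rewrite big_mkcond [leRHS]big_mkcond /=; apply: ler_sum => -[[T B] a] _ /=.
  case: (T =P set0) => //= _; case: (B =P set0) => //= _.
  case: ifP => [large|_]; last by rewrite !mulr_ge0 ?exprn_ge0.
  apply: le_trans (class_lower _ half01 _ (lexx _)) _.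
    by rewrite mulr_ge0 // ltW.
  rewrite ler_wpM2r // -exprD expR_tau //.
  have -> : 2%:R^-1 ^+ 2 / 8%:R = 32%:R^-1 :> R by field.
  have : b%:R * (#|T| + #|B|)%:R <= q * #|common T B|%:R.
    by rewrite /q ler_pdivlMl ?ltr0n // mulrA -!natrM ler_nat.
  have : K * L * (#|T| + #|B|)%:R <= b%:R * (#|T| + #|B|)%:R by rewrite ler_wpM2r.
  rewrite KE; have := mulr_ge0 (ltW L_gt0) (ler0n R (#|T| + #|B|)).
  by rewrite -!mulrA; move: (q * _) (b%:R * _) (L * _) => u v w; lra.
rewrite (sum_label N (fun p : {set V} * {set V} => (p.1 != set0) && (p.2 != set0))
  (fun p => tau ^+ #|p.1| * tau ^+ #|p.2| * Om)) -mulr_suml.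
rewrite -(pair_big (fun T : {set V} => T != set0)
  (fun B : {set V} => B != set0) (fun T B => tau ^+ #|T| * tau ^+ #|B|)) /=.
under eq_bigr do rewrite -mulr_sumr.
rewrite -mulr_suml -/S1 -expr2 mulrA ler_wpM2r // ler_wpM2r ?sqr_ge0 //.
by rewrite ler_nat.
Qed.

Let wide (T : {set V}) : bool :=
  (T != set0) && (d * #|T| <= 4 * #|nbhds E T|)%N.

(* The maximum keeps the expectation large enough for the tail bound when the
   hull is nearly everything. *)
Let outside (T : {set V}) : R := Num.max #|~: hull E d T|%:R (n%:R / 256%:R).

Let bad_outside : {set labelling} := \bigcup_(p : {set V} * 'I_N | wide p.1)
  [set f | (1 + 1) * (q * outside p.1) <= #|~: hull E d p.1 :&: class f p.2|%:R].

Let set_label_sum (P : pred {set V}) (F : {set V} * 'I_N -> {set labelling}) :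
    (forall T a, P T -> wide T /\ #|F (T, a)|%:R <= tau ^+ #|T| * Om) ->
  #|\bigcup_(p | P p.1) F p|%:R <= n%:R * S1 * Om.
Proof.
move=> hF; apply: le_trans (card_bigcup_le _ _ _) _.
apply: (@le_trans _ _ (\sum_(p : {set V} * 'I_N | p.1 != set0) tau ^+ #|p.1| * Om)).
  rewrite big_mkcond [leRHS]big_mkcond /=; apply: ler_sum => -[T a] _ /=.
  case: ifP => [/(hF T a)[/andP[-> _]]//|_].
  by case: ifP => // _; rewrite mulr_ge0 ?exprn_ge0.
rewrite (sum_label N (fun T : {set V} => T != set0) (fun T => tau ^+ #|T| * Om)).
rewrite -mulr_suml -/S1 mulrA ler_wpM2r // ler_wpM2r //.
by rewrite ler_nat.
Qed.

Let wide_card T : wide T -> d%:R * #|T|%:R <= 4%:R * n%:R :> R.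
Proof.
move=> /andP[_ h]; rewrite -!natrM ler_nat; apply: leq_trans h _.
by rewrite leq_mul2l max_card.
Qed.

Let card_bad_outside : #|bad_outside|%:R <= n%:R * S1 * Om.
Proof.
apply: set_label_sum => T a wT; split=> //=.
have out0 : n%:R / 256%:R <= outside T by rewrite le_max lexx orbT.
apply: le_trans (class_upper _ _ _ _) _.
- by rewrite ltr01 lexx.
- rewrite mulr_ge0 //; first by rewrite ltW.
  by apply: le_trans out0; rewrite divr_ge0.
- by rewrite ler_wpM2l // ?(ltW q_gt0) // le_max lexx.
- rewrite ler_wpM2r // expR_tau // expr1n.
  have h1 : K * L * #|T|%:R <= q * (4%:R * n%:R).
    apply: (@le_trans _ _ (d%:R / N%:R * #|T|%:R)); first by rewrite ler_wpM2r.
    by rewrite dqE -mulrA ler_wpM2l ?wide_card // ltW.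
  have h2 : q * (n%:R / 256%:R) <= q * outside T by rewrite ler_wpM2l // ltW.
  move: h1 h2; have -> : q * (4%:R * n%:R) = 4%:R * (q * n%:R) by ring.
  have -> : q * (n%:R / 256%:R) = q * n%:R / 256%:R by rewrite mulrA.
  rewrite KE; move: (q * n%:R) (q * outside T) (#|T|%:R : R) => u v w.
  by lra.
Qed.

Let far (T : {set V}) : bool := wide T && (n <= 64 * #|~: hull E d T|)%N.

(* A lower bound for the expected number of edges, of the matching that leaves the
   hull, with both ends in a given class. *)
Let goal_size (T : {set V}) : R := q * q * (lam * (d%:R * #|T|%:R) / (4%:R * 256%:R)).

(* The matching is chosen before the labels, so that the tail bound for pairs
   applies to it. *)
Let matching_spec (T : {set V}) (M : {set V} * (V -> V)) : Prop :=
  [/\ M.1 \subset hull E d T, {in M.1 &, injective M.2},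
      forall y, y \in M.1 -> M.2 y \notin hull E d T /\ E y (M.2 y)
    & goal_size T <= q * q * #|M.1|%:R].

Let exists_matching T : exists M, far T -> matching_spec T M.
Proof.
case: (boolP (far T)) => [/andP[wT h64]|_]; last by exists (set0, id).
have [] := @cut_matching R V E lam E_sym expE lam02 (hull E d T)
  (d%:R * #|T|%:R / 256%:R).
- apply: (@le_trans _ _ #|nbhds E T|%:R); last first.
    by rewrite ler_nat subset_leq_card // subsetUl.
  have /andP[_] := wT; rewrite -(ler_nat R) !natrM.
  have := ler0n R #|nbhds E T|; by move: (d%:R * _) (#|nbhds E T|%:R) => u v; lra.
- have := wide_card wT; move: h64; rewrite -(ler_nat R) natrM.
  by move: (d%:R * _) (#|~: _|%:R) (n%:R) => u v w; lra.
move=> Y0 [g [Y0sub ginj gP hM]]; exists (Y0, g) => _; split=> //=.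
rewrite /goal_size ler_wpM2l ?mulr_ge0 ?(ltW q_gt0) //.
by move: hM; move: (d%:R * _) (#|Y0|%:R) => u v; lra.
Qed.

Let matching : {set V} -> {set V} * (V -> V) := projT1 (choice exists_matching).
Let matchingP T : far T -> matching_spec T (matching T).
Proof. exact: (projT2 (choice exists_matching)). Qed.

Let kept (T : {set V}) (a : 'I_N) (f : labelling) : {set V} :=
  [set v in (matching T).1 | (f v == a) && (f ((matching T).2 v) == a)].

Let bad_matching : {set labelling} := \bigcup_(p : {set V} * 'I_N | far p.1)
  [set f | #|kept p.1 p.2 f|%:R <= (1 - 2%:R^-1) * goal_size p.1].

Let card_bad_matching : #|bad_matching|%:R <= n%:R * S1 * Om.
Proof.
apply: set_label_sum => T a farT; have [wT _] := andP farT; split=> //=.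
have [sub inj out size] := matchingP farT.
have goal0 : 0 <= goal_size T.
  case/andP: lam02 => l0 _; rewrite /goal_size mulr_ge0 ?mulr_ge0 ?(ltW q_gt0) //.
  by rewrite invr_ge0 mulr_ge0.
apply: le_trans (pair_lower _ inj _ goal0 size) _.
  move=> v vM; have [+ _] := out v vM; apply: contra.
  exact: (subsetP sub).
rewrite ler_wpM2r // expR_tau //.
have : K * (4%:R * L) * #|T|%:R <= q * q * (lam * (d%:R * #|T|%:R)).
  have -> : q * q * (lam * (d%:R * #|T|%:R)) = q ^+ 2 * (lam * d%:R) * #|T|%:R by ring.
  rewrite ler_wpM2r // /q exprVn [leRHS]mulrC ler_pdivlMr //.
  by rewrite exprn_gt0 // ltr0n.
rewrite /goal_size KE; have := mulr_ge0 (ltW L_gt0) (ler0n R #|T|).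
move: (lam * _) => u; move: (q * q) (#|T|%:R : R) => v w.
by lra.
Qed.

Variable mid : pred 'I_N.
Hypothesis mid_inner : forall t : 'I_N, mid t -> (0 < t)%N /\ (t.+1 < N)%N.

Let spread (f : labelling) : R := \sum_v (mid (f v))%:R * imbalance R E f v ^+ 2.

Let bad_spread : {set labelling} :=
  [set f | 20%:R * (n%:R * (q * Delta%:R)) <= spread f].

Let card_bad_spread : 10%:R * #|bad_spread|%:R <= Om.
Proof.
pose c := n%:R * (q * Delta%:R).
have c0 : 0 < c.
  rewrite mulr_gt0 // mulr_gt0 // ltr0n; exact: leq_trans dDelta.
have s0 f : 0 <= spread f.
  by apply: sumr_ge0 => v _; rewrite mulr_ge0 ?sqr_ge0.
have h1 : 20%:R * c * #|bad_spread|%:R <= \sum_f spread f.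
  rewrite mulr_natr -sumr_const big_mkcond /=; apply: ler_sum => f _.
  by rewrite inE; case: ifP.
have h2 : \sum_f spread f <= 2%:R * c * Om.
  rewrite exchange_big /=; apply: (@le_trans _ _ (\sum_(v : V) 2%:R * (q * Delta%:R) * Om)).
    apply: ler_sum => v _; apply: le_trans (second_moment _ N_gt0 E_irr mid_inner v) _.
    rewrite ler_wpM2r // -mulrA ler_wpM2l // mulrC ler_wpM2l ?(ltW q_gt0) //.
    by rewrite ler_nat.
  rewrite sumr_const -/n -[leLHS]mulr_natl /c le_eqVlt; apply/orP; left.
  by apply/eqP; ring.
have h3 := le_trans h1 h2; rewrite -(ler_pM2l c0) -(ler_pM2l (ltr0n R 2)).
by move: h3; lra.
Qed.

Let scale (x : R) c : x * q <= c -> x <= N%:R * c.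
Proof. by rewrite -ler_pdivrMl ?ltr0n // mulrC. Qed.

Let reservoir_common f (T B : {set V}) a : f \notin bad_common ->
  (N * b * (#|T| + #|B|) <= #|common T B|)%N ->
  (#|common T B| <= 2 * N * #|common T B :&: class f a|)%N.
Proof.
move=> fbad large; have [T0|Tn0] := eqVneq T set0.
  by rewrite /common /nbhds T0 big_set0 set0I cards0.
have [B0|Bn0] := eqVneq B set0.
  by rewrite /common /nbhds B0 big_set0 setI0 cards0.
have : ~~ (#|common T B :&: class f a|%:R <=
    (1 - 2%:R^-1) * (q * #|common T B|%:R)).
  apply: contra fbad => h; apply/bigcupP; exists (T, B, a); rewrite /= ?inE //.
  by rewrite Tn0 Bn0.
rewrite -ltNge => /ltW h; rewrite -(ler_nat R) mulnAC natrM -[leRHS]mulrC.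
apply: scale; rewrite natrM; move: h.
by move: (#|_ :&: class _ _|%:R) (#|_|%:R) => u v; lra.
Qed.

Let reservoir_outside f (T : {set V}) a : f \notin bad_outside -> wide T ->
  (256 * N * #|class f a :\: hull E d T| <= maxn (512 * #|~: hull E d T|) (2 * n))%N.
Proof.
move=> fbad wT; rewrite setDE setIC.
have : ~~ ((1 + 1) * (q * outside T) <= #|~: hull E d T :&: class f a|%:R).
  by apply: contra fbad => h; apply/bigcupP; exists (T, a); rewrite ?inE.
rewrite -ltNge /outside leq_max => /ltW; move: #|_ :&: _| #|~: _| => c o.
case: (leP (o%:R : R) (n%:R / 256%:R)) => _ h; apply/orP; [right|left].
  rewrite -(ler_nat R) !natrM -mulrA [X in _ * X <= _]mulrC mulrA.
  rewrite -ler_pdivlMr ?ltr0n // -/q mulrC.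
  by move: h; lra.
rewrite -(ler_nat R) !natrM -mulrA [X in _ * X <= _]mulrC mulrA.
rewrite -ler_pdivlMr ?ltr0n // -/q mulrC.
by move: h; lra.
Qed.

Let reservoir_matching f (T : {set V}) a : f \notin bad_matching -> far T ->
  exists (Y0 : {set V}) (g : V -> V),
    [/\ Y0 \subset hull E d T :&: class f a, {in Y0 &, injective g},
        forall y, y \in Y0 -> g y \in class f a :\: hull E d T /\ E y (g y)
      & (kap * #|T| <= #|Y0|)%N].
Proof.
move=> fbad fT; have [sub inj out size] := matchingP fT.
have : ~~ (#|kept T a f|%:R <= (1 - 2%:R^-1) * goal_size T).
  by apply: contra fbad => h; apply/bigcupP; exists (T, a); rewrite ?inE.
rewrite -ltNge => /ltW h; exists (kept T a f), (matching T).2; split.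
- apply/subsetP=> v; rewrite inE in_setI => /and3P[vM va _].
  by rewrite (subsetP sub) // inE va.
- by move=> v w; rewrite !inE => /andP[vM _] /andP[wM _]; apply: inj.
- move=> v; rewrite inE => /and3P[vM _ va]; have [gv Egv] := out v vM.
  by rewrite in_setD gv inE va.
- rewrite -(ler_nat R) natrM; apply: le_trans h.
  have : K * kap%:R * #|T|%:R <= q * q * (lam * (d%:R * #|T|%:R)).
    have -> : q * q * (lam * (d%:R * #|T|%:R)) = q ^+ 2 * (lam * d%:R) * #|T|%:R by ring.
    rewrite ler_wpM2r // /q exprVn [leRHS]mulrC ler_pdivlMr //.
    by rewrite exprn_gt0 // ltr0n.
  rewrite /goal_size KE; have := mulr_ge0 (ler0n R kap) (ler0n R #|T|).
  move: (lam * _) => u; move: (q * q) (#|T|%:R : R) => v w.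
  by lra.
Qed.

Let total_bad : n%:R ^+ 2 * tau + n%:R ^+ 2 * tau + n%:R * S1 ^+ 2 + n%:R * S1 + n%:R * S1
  < 9%:R / 10%:R.
Proof.
have n4 : 4%:R <= n%:R :> R by rewrite ler_nat.
have := S1_le; have := S1_ge0; have := tau_n; have := tau_ge0.
move: tau S1 (n%:R : R) n4 => t s x x4 t0 h s0 hs.
have z0 : 0 <= x ^+ 2 * t by rewrite mulr_ge0 ?sqr_ge0.
have z16 : 16%:R * (x ^+ 2 * t) <= 1.
  apply: le_trans h; have -> : t * x ^+ 4 = x ^+ 2 * (x ^+ 2 * t) by ring.
  by rewrite ler_wpM2r // expr2; nra.
have xs : x * s <= 2%:R * (x ^+ 2 * t).
  have -> : 2%:R * (x ^+ 2 * t) = x * (2%:R * x * t) by ring.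
  by rewrite ler_wpM2l //; lra.
have xs2 : x * s ^+ 2 <= (x ^+ 2 * t) ^+ 2.
  have h1 : s ^+ 2 <= (2%:R * x * t) ^+ 2.
    by rewrite lerXn2r ?nnegrE //; apply: le_trans hs.
  apply: (@le_trans _ _ (x * (2%:R * x * t) ^+ 2)); first by rewrite ler_wpM2l //; lra.
  have -> : x * (2%:R * x * t) ^+ 2 = 4%:R * (x ^+ 3 * t ^+ 2) by ring.
  have -> : (x ^+ 2 * t) ^+ 2 = x * (x ^+ 3 * t ^+ 2) by ring.
  by rewrite ler_wpM2r // mulr_ge0 ?exprn_ge0 //; lra.
move: xs xs2 z0 z16; move: (x * s) (x * s ^+ 2) (x ^+ 2 * t) => u v z xs xs2 z0 z16.
have : z ^+ 2 <= z * 16%:R^-1 by rewrite expr2 ler_wpM2l //; lra.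
by lra.
Qed.

(** The third property fails with probability at most [1 / 10], by Markov's
    inequality; by the tail bounds, the others together fail with probability less
    than [9 / 10]. *)
Lemma good_labelling : exists f : labelling,
  [/\ forall v a, #|nbhd E v :&: class f a|%:R < (1 + eta) * (N%:R^-1 * Delta%:R),
      forall v a, (1 - eta) * (N%:R^-1 * d%:R) < #|nbhd E v :&: class f a|%:R,
      \sum_v (mid (f v))%:R * imbalance R E f v ^+ 2 <
        20%:R * (#|V|%:R * (N%:R^-1 * Delta%:R))
    & forall a, good_reservoir E d N b kap (class f a)].
Proof.
pose bad := bad_high :|: bad_low :|: bad_common :|: bad_outside :|: bad_matching
  :|: bad_spread.
have cbad : #|bad|%:R < Om.
  have cU (X Y : {set labelling}) : #|X :|: Y|%:R <= #|X|%:R + #|Y|%:R :> R.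
    by rewrite -natrD ler_nat card_setU_le.
  have := cU (bad_high :|: bad_low :|: bad_common :|: bad_outside :|: bad_matching) bad_spread.
  have := cU (bad_high :|: bad_low :|: bad_common :|: bad_outside) bad_matching.
  have := cU (bad_high :|: bad_low :|: bad_common) bad_outside.
  have := cU (bad_high :|: bad_low) bad_common.
  have := cU bad_high bad_low; rewrite -/bad.
  have := card_bad_high; have := card_bad_low; have := card_bad_common.
  have := card_bad_outside; have := card_bad_matching; have := card_bad_spread.
  have : (n%:R ^+ 2 * tau + n%:R ^+ 2 * tau + n%:R * S1 ^+ 2 + n%:R * S1 + n%:R * S1) * Om
    < 9%:R / 10%:R * Om by rewrite ltr_pM2r.
  rewrite !mulrDl.
  move: (n%:R ^+ 2 * tau * Om) (n%:R * S1 ^+ 2 * Om) (n%:R * S1 * Om) => x1 x2 x3.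
  move: (#|bad_high|%:R) (#|bad_low|%:R) (#|bad_common|%:R) (#|bad_outside|%:R)
    (#|bad_matching|%:R) (#|bad_spread|%:R) (#|_ :|: bad_low|%:R)
    (#|_ :|: bad_common|%:R) (#|_ :|: bad_outside|%:R) (#|_ :|: bad_matching|%:R)
    (#|bad|%:R) Om => y1 y2 y3 y4 y5 y6 z1 z2 z3 z4 z5 o.
  lra.
have [f] : exists f, f \notin bad.
  apply/existsP; apply: contraTT cbad; rewrite negb_exists => /forallP h.
  rewrite -leNgt ler_nat -cardsT subset_leq_card //.
  by apply/subsetP=> f _; apply/negPn/h.
rewrite !in_setU !negb_or -!andbA => /and5P[f1 f2 f3 f4 /andP[f5 f6]].
have high v a : #|nbhd E v :&: class f a|%:R < (1 + eta) * (q * Delta%:R).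
  rewrite ltNge; apply: contra f1 => h; apply/bigcupP; exists (v, a) => //.
  by rewrite inE.
have low v a : (1 - eta) * (q * d%:R) < #|nbhd E v :&: class f a|%:R.
  rewrite ltNge; apply: contra f2 => h; apply/bigcupP; exists (v, a) => //.
  by rewrite inE.
exists f; split=> //; first by rewrite ltNge; move: f6; rewrite inE.
move=> a; split.
- move=> v; rewrite -(ler_nat R) mulnAC natrM -[leRHS]mulrC.
  apply: scale; rewrite natrM; move: (low v a); rewrite [q * _]mulrC.
  have : 0 <= d%:R * q by rewrite mulr_ge0 // ltW.
  move: (#|_ :&: class _ _|%:R) (d%:R * q) => u v' p0 h.
  have : 0 <= (2%:R^-1 - eta) * v' by rewrite mulr_ge0 // subr_ge0.
  by lra.
- by move=> T B; apply: reservoir_common.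
- by move=> T T0 wT; apply: reservoir_outside => //; rewrite /wide T0.
- move=> T T0 wT h64; apply: reservoir_matching => //.
  by rewrite /far /wide T0 wT.
Qed.

End RandomLabelling.

(** * A nearly spanning path forest *)

Section PathForest.
Variables (R : realType) (V : finType) (E : rel V).
Hypothesis E_sym : symmetric E.
Variables (N d Delta k : nat).
Hypotheses (N_gt0 : (0 < N)%N) (d_gt0 : (0 < d)%N).
Hypothesis min_deg : forall v, (d <= #|nbhd E v|)%N.
Hypothesis max_deg : forall v, (#|nbhd E v| <= Delta)%N.
Variable eta : R.
Hypothesis eta01 : 0 < eta <= 20%:R^-1.
Hypothesis Delta_d : Delta%:R <= (1 + eta) * d%:R.
Hypotheses (k_gt1 : (1 < k)%N) (kN : (k <= N)%N).
Hypothesis k_N : (1 - eta) * N%:R <= k%:R.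
Hypothesis N_n : N%:R <= eta * #|V|%:R.
Hypothesis d_N3 : 20%:R * N%:R ^+ 3 <= eta ^+ 2 * d%:R.
Variable f : {ffun V -> 'I_N}.

Definition inner (t : 'I_N) : bool := (0 < t)%N && (t.+1 < k)%N.

Hypothesis high : forall v a,
  #|nbhd E v :&: class f a|%:R < (1 + eta) * (N%:R^-1 * Delta%:R).
Hypothesis low : forall v a,
  (1 - eta) * (N%:R^-1 * d%:R) < #|nbhd E v :&: class f a|%:R.
Hypothesis spread : \sum_v (inner (f v))%:R * imbalance R E f v ^+ 2 <
  20%:R * (#|V|%:R * (N%:R^-1 * Delta%:R)).

Let lab (v : V) : nat := f v.
Let x : R := #|V|%:R / N%:R.
Let y : R := d%:R / N%:R.
Let NR_gt0 : 0 < N%:R :> R. Proof. by rewrite ltr0n. Qed.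
Let y_gt0 : 0 < y. Proof. by rewrite divr_gt0 // ltr0n. Qed.
Let x_ge0 : 0 <= x. Proof. by rewrite divr_ge0. Qed.
Let eta_gt0 : 0 < eta. Proof. by case/andP: eta01. Qed.
Let eta_le : eta <= 20%:R^-1. Proof. by case/andP: eta01. Qed.

Lemma layer_class (a : 'I_N) : layer lab a = class f a.
Proof. by apply/setP=> v; rewrite !inE. Qed.

Lemma layer_high v t : (t < N)%N ->
  #|nbhd E v :&: layer lab t|%:R < (1 + eta) ^+ 2 * y.
Proof.
move=> tN; rewrite -[t]/(nat_of_ord (Ordinal tN)) layer_class.
apply: lt_le_trans (high v _) _; rewrite expr2 -mulrA ler_wpM2l //.
  by apply: addr_ge0 => //; apply: ltW.
by rewrite mulrC mulrA ler_wpM2r // invr_ge0 ltW.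
Qed.

Lemma layer_low v t : (t < N)%N ->
  (1 - eta) * y < #|nbhd E v :&: layer lab t|%:R.
Proof.
move=> tN; rewrite -[t]/(nat_of_ord (Ordinal tN)) layer_class.
by apply: le_lt_trans (low v _); rewrite /y [d%:R / _]mulrC.
Qed.

(* The common load bound: at least every degree into a layer, and close to all of
   them. *)
Let D : nat := Num.truncn ((1 + eta) ^+ 2 * y).

Let D_high v t : (t < N)%N -> (#|nbhd E v :&: layer lab t| <= D)%N.
Proof.
move=> tN; rewrite /D truncn_ge_nat; last first.
  by rewrite mulr_ge0 ?sqr_ge0 // ltW.
exact: ltW (layer_high _ tN).
Qed.

Let D_le : D%:R <= (1 + eta) ^+ 2 * y.
Proof. by rewrite truncn_le mulr_ge0 ?sqr_ge0 // ltW. Qed.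

Let card_V_gt0 : (0 < #|V|)%N.
Proof.
rewrite lt0n; apply: contraTneq N_n => ->; rewrite mulr0 -ltNge.
exact: NR_gt0.
Qed.

Let D_ge : (1 - eta) * y <= D%:R.
Proof.
have /card_gt0P[v _] := card_V_gt0.
by apply: le_trans (ltW (layer_low v N_gt0)) _; rewrite ler_nat D_high.
Qed.

Let nbhd_sum (X : {set V}) :
  (\sum_v #|nbhd E v :&: X| = \sum_(u in X) #|nbhd E u|)%N.
Proof.
transitivity (\sum_v \sum_(u in X) E v u)%N.
  apply: eq_bigr => v _; rewrite -sum1_card big_mkcond [RHS]big_mkcond /=.
  by apply: eq_bigr => u _; rewrite in_setI in_nbhd andbC; do 2 case: ifP => //=; case: (E v u).
rewrite exchange_big /=; apply: eq_bigr => u _.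
rewrite -sum1_card [RHS]big_mkcond /=; apply: eq_bigr => v _.
by rewrite in_nbhd E_sym; case: (E u v).
Qed.

Let dR_gt0 : 0 < d%:R :> R. Proof. by rewrite ltr0n. Qed.

Let layer0_low : (1 - eta) * x <= (1 + eta) * #|layer lab 0|%:R.
Proof.
have h1 : #|V|%:R * ((1 - eta) * y) <= (\sum_v #|nbhd E v :&: layer lab 0|)%N%:R.
  rewrite natr_sum mulr_natl -sumr_const; apply: ler_sum => v _.
  exact: ltW (layer_low v N_gt0).
have h2 : (\sum_v #|nbhd E v :&: layer lab 0|)%N%:R <= Delta%:R * #|layer lab 0|%:R :> R.
  rewrite nbhd_sum -natrM ler_nat mulnC -sum_nat_const.
  by apply: leq_sum => v _; apply: max_deg.
have h3 : Delta%:R * #|layer lab 0|%:R <= (1 + eta) * d%:R * #|layer lab 0|%:R.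
  by rewrite ler_wpM2r.
rewrite -(ler_pM2l dR_gt0); have := le_trans h1 (le_trans h2 h3).
have -> : #|V|%:R * ((1 - eta) * y) = d%:R * ((1 - eta) * x).
  by rewrite /x /y; ring.
have -> : (1 + eta) * d%:R * #|layer lab 0|%:R = d%:R * ((1 + eta) * #|layer lab 0|%:R) by ring.
by [].
Qed.

Let layer0_high : #|layer lab 0|%:R <= (1 + eta) ^+ 2 * x.
Proof.
have h1 : (\sum_v #|nbhd E v :&: layer lab 0|)%N%:R <= #|V|%:R * ((1 + eta) ^+ 2 * y).
  rewrite natr_sum mulr_natl -sumr_const; apply: ler_sum => v _.
  exact: ltW (layer_high v N_gt0).
have h2 : d%:R * #|layer lab 0|%:R <= (\sum_v #|nbhd E v :&: layer lab 0|)%N%:R :> R.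
  rewrite nbhd_sum -natrM ler_nat mulnC -sum_nat_const.
  by apply: leq_sum => v _; apply: min_deg.
rewrite -(ler_pM2l dR_gt0); apply: le_trans (le_trans h2 h1) _.
by rewrite le_eqVlt; apply/orP; left; apply/eqP; rewrite /x /y; ring.
Qed.

Let ind (v : V) : R := imbalance R E f v.

Let imbalance_in_out v : (0 < lab v)%N ->
  (indeg E lab v)%:R - (outdeg E lab v)%:R = ind v.
Proof.
move=> v0; rewrite /ind /imbalance /indeg /outdeg.
have cnt (P : pred V) : #|nbhd E v :&: [set u | P u]|%:R = \sum_(u in nbhd E v) (P u)%:R :> R.
  rewrite -sum1_card natr_sum big_mkcond [RHS]big_mkcond /=.
  by apply: eq_bigr => u _; rewrite in_setI inE; case: (u \in nbhd E v) => //=; case: (P u).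
rewrite /layer !cnt -sumrB; apply: eq_bigr => u _; rewrite /drift.
by rewrite -eqSS prednK.
Qed.

Let deficit : nat := (\sum_(v | lab v < k.-1) (if lab v == 0 then D - outdeg E lab v
                             else indeg E lab v - outdeg E lab v))%N.

(* An imbalance z is bounded by 2 * |z| <= a + z ^ 2 / a. This a is so small that
   its sum over all vertices is eta * x * y, and so large that the squares, which
   average about y, are negligible when d is large compared with N ^ 3. *)
Let a : R := eta * (d%:R / N%:R ^+ 2).

Let a_gt0 : 0 < a. Proof. by rewrite mulr_gt0 // divr_gt0 // exprn_gt0. Qed.

Let deficit_le : deficit%:R <= 6%:R * eta * (x * y).
Proof.
pose bound v : R := (lab v == 0)%:R * (((1 + eta) ^+ 2 - (1 - eta)) * y) +
  (a / 2%:R + (inner (f v))%:R * ind v ^+ 2 / (2%:R * a)).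
have rest_ge0 v : 0 <= a / 2%:R + (inner (f v))%:R * ind v ^+ 2 / (2%:R * a).
  have a0 := ltW a_gt0; apply: addr_ge0; first by rewrite divr_ge0.
  by apply: divr_ge0; [apply: mulr_ge0 => //; apply: sqr_ge0|rewrite mulr_ge0].
have term v : (lab v < k.-1)%N ->
    (if lab v == 0 then D - outdeg E lab v
      else indeg E lab v - outdeg E lab v)%N%:R <= bound v.
  move=> vk; rewrite /bound; case: eqP => [v0|/eqP v0] /=.
    have k1N : (1 < N)%N by apply: leq_trans k_gt1 kN.
    have h1 : (1 - eta) * y < (outdeg E lab v)%:R.
      by rewrite /outdeg v0; apply: layer_low.
    have h2 := rest_ge0 v.
    rewrite mul1r natrB; first by move: D_le h1 h2; lra.
    by rewrite /outdeg v0 D_high.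
  have lv0 : (0 < lab v)%N by rewrite lt0n.
  have mv : inner (f v) by apply/andP; split=> //; move: vk; rewrite -ltnS prednK // ltnW.
  rewrite mv mul0r mul1r add0r.
  apply: (@le_trans _ _ `|ind v|).
    rewrite -imbalance_in_out //; case: (leqP (indeg E lab v) (outdeg E lab v)) => h.
      by rewrite (eqP (h : _ - _ == 0)%N) normr_ge0.
    by rewrite natrB ?ler_norm // ltnW.
  have sq : 0 <= (`|ind v| - a) ^+ 2 by apply: sqr_ge0.
  have -> : ind v ^+ 2 / (2%:R * a) = `|ind v| ^+ 2 / (2%:R * a) by rewrite real_normK // num_real.
  have -> : a / 2%:R + `|ind v| ^+ 2 / (2%:R * a) = (a ^+ 2 + `|ind v| ^+ 2) / (2%:R * a).
    by field; rewrite gt_eqF.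
  have a2 : 0 < 2%:R * a by rewrite mulr_gt0.
  rewrite (ler_pdivlMr _ _ a2).
  by move: sq a_gt0; move: (`|ind v|) => z; lra.
have sumb : deficit%:R <= \sum_v bound v.
  rewrite [leRHS](bigID (fun v => lab v < k.-1)%N) /=.
  apply: (@le_trans _ _ (\sum_(v | (lab v < k.-1)%N) bound v)).
    by rewrite /deficit natr_sum; apply: ler_sum; exact: term.
  rewrite lerDl; apply: sumr_ge0 => v _; apply: addr_ge0 => //.
    rewrite mulr_ge0 // mulr_ge0 ?(ltW y_gt0) //.
    by move: eta_gt0; nra.
have tot : \sum_v bound v = #|layer lab 0|%:R * (((1 + eta) ^+ 2 - (1 - eta)) * y) +
    (#|V|%:R * (a / 2%:R) +
      (\sum_v (inner (f v))%:R * ind v ^+ 2) / (2%:R * a)).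
  rewrite /bound big_split /= -mulr_suml; congr (_ * _ + _).
    rewrite -sum1_card natr_sum [RHS]big_mkcond /=.
    by apply: eq_bigr => v _; rewrite inE; case: eqP.
  by rewrite big_split /= sumr_const -mulr_suml -[X in X + _]mulr_natl.
have e1 : #|layer lab 0|%:R * (((1 + eta) ^+ 2 - (1 - eta)) * y) <=
    (1 + eta) ^+ 2 * x * (((1 + eta) ^+ 2 - (1 - eta)) * y).
  by rewrite ler_wpM2r //; rewrite mulr_ge0 ?(ltW y_gt0) //; move: eta_gt0; nra.
have e2 : #|V|%:R * (a / 2%:R) = eta / 2%:R * (x * y).
  by rewrite /a /x /y; field; rewrite gt_eqF.
have e3 : (\sum_v (inner (f v))%:R * ind v ^+ 2) / (2%:R * a) <=
    2%:R * eta * (x * y).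
  have a2 : 0 < 2%:R * a by rewrite mulr_gt0.
  rewrite (ler_pdivrMr _ _ a2); apply: le_trans (ltW spread) _.
  have h1 : N%:R^-1 * Delta%:R <= (1 + eta) * y.
    by rewrite mulrC /y mulrA ler_wpM2r // invr_ge0 ltW.
  have h2 : 20%:R * (#|V|%:R * (N%:R^-1 * Delta%:R)) <= 20%:R * (#|V|%:R * (2%:R * y)).
    rewrite ler_wpM2l // ler_wpM2l //; apply: le_trans h1 _.
    by rewrite ler_wpM2r ?(ltW y_gt0) //; move: eta_le; lra.
  apply: le_trans h2 _.
  have -> : 2%:R * eta * (x * y) * (2%:R * a) =
      4%:R * (#|V|%:R * y) * (eta ^+ 2 * d%:R / N%:R ^+ 3).
    by rewrite /a /x /y; field; rewrite gt_eqF.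
  have h3 : 20%:R <= eta ^+ 2 * d%:R / N%:R ^+ 3.
    by rewrite ler_pdivlMr // exprn_gt0.
  have h4 : 0 <= #|V|%:R * y by rewrite mulr_ge0 // ltW.
  have -> : 20%:R * (#|V|%:R * (2%:R * y)) = 2%:R * (#|V|%:R * y) * 20%:R by ring.
  apply: le_trans (_ : 2%:R * (#|V|%:R * y) * (eta ^+ 2 * d%:R / N%:R ^+ 3) <= _).
    by rewrite ler_wpM2l // mulr_ge0.
  rewrite ler_wpM2r //; first by rewrite divr_ge0 ?mulr_ge0 ?sqr_ge0 ?exprn_ge0 ?ltW.
  by move: h4; lra.
apply: le_trans sumb _; rewrite tot e2.
have e4 : (1 + eta) ^+ 2 * x * (((1 + eta) ^+ 2 - (1 - eta)) * y) <=
    (7%:R / 2%:R) * eta * (x * y).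
  have -> : (1 + eta) ^+ 2 * x * (((1 + eta) ^+ 2 - (1 - eta)) * y) =
    (1 + eta) ^+ 2 * ((1 + eta) ^+ 2 - (1 - eta)) * (x * y) by ring.
  have xy0 : 0 <= x * y by rewrite mulr_ge0 // ltW.
  apply: (ler_wpM2r xy0).
  have sq : eta ^+ 2 <= eta / 20%:R by rewrite expr2 ler_wpM2l // ltW.
  have f1 : (1 + eta) ^+ 2 <= 9%:R / 8%:R by move: sq eta_gt0 eta_le; lra.
  have f2 : (1 + eta) ^+ 2 - (1 - eta) <= 61%:R / 20%:R * eta.
    by move: sq eta_gt0 eta_le; lra.
  have f0 : 0 <= (1 + eta) ^+ 2 - (1 - eta) by move: eta_gt0; nra.
  apply: le_trans (ler_pM (sqr_ge0 _) f0 f1 f2) _.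
  by move: eta_gt0; lra.
move: (le_trans e1 e4) e3; set u := #|_|%:R * _; set v := _ / (2%:R * a); set w := x * y.
by clearbody u v w; lra.
Qed.

(** The deficit is a fraction of order [eta] of a layer, and [k] is nearly [N], so the
    paths from layer 0 cover all but a fraction of order [eta] of the vertices. *)
Lemma path_forest : exists P : seq (seq V),
  [/\ all (good_path E (layer lab 0 :|: layer lab k.-1)) P, uniq (flatten P),
      {subset flatten P <= [set v | (lab v < k)%N]}
    & (1 - 11%:R * eta) * #|V|%:R <= (size (flatten P))%:R].
Proof.
have D_gt0 : (0 < D)%N.
  rewrite -(ltr0n R); apply: lt_le_trans D_ge.
  by rewrite mulr_gt0 // subr_gt0; apply: le_lt_trans eta_le _; rewrite invf_lt1 ?ltr1n.
pose def := (deficit %/ D).+1.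
have kN1 j : (j <= k.-1)%N -> (j < N)%N.
  by move=> jk; apply: leq_trans kN; rewrite -(prednK (ltnW k_gt1)) ltnS.
have defD : (deficit <= D * def)%N by rewrite mulnC ltnW // ltn_ceil.
have [P [gP uP sP PL cP]] := layered_paths (E := E) k_gt1
  (@layered_hall V E lab k D def E_sym D_gt0
    (fun v _ => D_high v (leq_ltn_trans (leq_pred _) (ltn_ord (f v))))
    (fun v vk => D_high v (kN1 _ vk)) defD).
exists P; split=> //.
have szP : size (flatten P) = (k * size P)%N.
  elim: (P) sP => [|p P' IH] sP' /=; first by rewrite muln0.
  rewrite size_cat (sP' p) ?mem_head // IH ?mulnS // => p' p'P.
  by apply: sP'; rewrite inE p'P orbT.
rewrite szP natrM.
have h1 : #|layer lab 0|%:R <= (size P)%:R + def%:R :> R by rewrite -natrD ler_nat.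
have h2 : def%:R <= deficit%:R / D%:R + 1 :> R.
  rewrite /def -natr1 lerD2r ler_pdivlMr ?ltr0n // -natrM ler_nat.
  exact: leq_trunc_div.
have xy0 : 0 <= eta * x by rewrite mulr_ge0 // ltW.
have h3 : deficit%:R / D%:R <= 20%:R / 3%:R * eta * x.
  rewrite ler_pdivrMr ?ltr0n //; apply: le_trans deficit_le _.
  have : 20%:R / 3%:R * eta * x * ((1 - eta) * y) <= 20%:R / 3%:R * eta * x * D%:R.
    by rewrite ler_wpM2l // -mulrA mulr_ge0 // divr_ge0.
  apply: le_trans.
  have -> : 6%:R * eta * (x * y) = 6%:R * (eta * x * y) by ring.
  have -> : 20%:R / 3%:R * eta * x * ((1 - eta) * y) =
    20%:R / 3%:R * (1 - eta) * (eta * x * y) by ring.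
  apply: (ler_wpM2r (mulr_ge0 xy0 (ltW y_gt0))).
  by move: eta_le; lra.
have h4 : 1 <= eta * x.
  by rewrite /x mulrA ler_pdivlMr // mul1r.
have h5 : (1 - 2%:R * eta) * x <= #|layer lab 0|%:R.
  have e0 : 0 < 1 + eta by move: eta_gt0; lra.
  rewrite -(ler_pM2l e0); apply: le_trans layer0_low; rewrite mulrA ler_wpM2r //.
  by move: eta_gt0; nra.
have h6 : (1 - 9%:R * eta - 2%:R / 3%:R * eta) * x <= (size P)%:R.
  by move: h1 h2 h3 h4 h5; lra.
have h7 : (1 - 11%:R * eta) * #|V|%:R <= k%:R * ((1 - 9%:R * eta - 2%:R / 3%:R * eta) * x).
  have c0 : 0 <= 1 - 9%:R * eta - 2%:R / 3%:R * eta by move: eta_le; lra.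
  have -> : k%:R * ((1 - 9%:R * eta - 2%:R / 3%:R * eta) * x) =
    (1 - 9%:R * eta - 2%:R / 3%:R * eta) * (k%:R / N%:R) * #|V|%:R.
    by rewrite /x; ring.
  have kN' : 1 - eta <= k%:R / N%:R by rewrite ler_pdivlMr.
  rewrite ler_wpM2r //; apply: le_trans (ler_wpM2l c0 kN').
  by move: eta_gt0; nra.
by apply: le_trans h7 _; rewrite ler_wpM2l.
Qed.

End PathForest.

(** * A long cycle, under explicit bounds *)

(** Since [(1 - C^-1) ^ s <= expR (- s / C)]. *)
Lemma rounds_suffice (R : realType) (L : R) (C s m : nat) :
  (0 < C)%N -> C%:R * L <= s%:R -> m%:R < expR L -> (C.-1 ^ s * m < C ^ s)%N.
Proof.
move=> C0 CL mL; have CR : 0 < C%:R :> R by rewrite ltr0n.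
rewrite -(ltr_nat R) natrM !natrX.
have C1 : C.-1%:R = C%:R * (1 - C%:R^-1) :> R.
  by rewrite mulrBr mulr1 divff ?gt_eqF // -[C in RHS]prednK // -natr1 addrK.
rewrite C1 exprMn -mulrA gtr_pMr ?exprn_gt0 //.
have h : (1 - C%:R^-1) ^+ s <= expR (- L).
  apply: le_trans (_ : expR (- C%:R^-1 * s%:R) <= _).
    apply: expR_exprn_ge; rewrite subr_ge0 invf_le1 // ler1n //.
  by rewrite ler_expR mulNr lerN2 ler_pdivlMl.
apply: le_lt_trans (_ : expR (- L) * m%:R < 1); first by rewrite ler_wpM2r.
by rewrite expRN mulrC ltr_pdivrMr ?expR_gt0 // mul1r.
Qed.

Section LongCycle.
Variables (R : realType) (V : finType) (E : rel V) (lam : R).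
Hypotheses (E_sym : symmetric E) (E_irr : irreflexive E).
Hypothesis expE : expander E lam.
Hypothesis lam02 : 0 <= lam <= 2%:R.
Variables (k s d Delta b C : nat).
Let N := (k + s).+1.
Hypothesis C_large : (4 + 8 * (100 * 800) <= C)%N.
Hypotheses (d_gt0 : (0 < d)%N) (b_gt0 : (0 < b)%N) (k_gt1 : (1 < k)%N).
Hypothesis min_deg : forall v, (d <= #|nbhd E v|)%N.
Hypothesis max_deg : forall v, (#|nbhd E v| <= Delta)%N.
Variables (K L eta : R).
Hypothesis KE : K = 8%:R ^+ 5.
Hypothesis n_ge4 : (4 <= #|V|)%N.
Hypothesis n_expL : #|V|%:R <= expR L.
Hypothesis eta01 : 0 < eta <= 20%:R^-1.
Hypothesis Delta_d : Delta%:R <= (1 + eta) * d%:R.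
Hypothesis k_N : (1 - eta) * N%:R <= k%:R.
Hypothesis s_large : C%:R * L <= s%:R.
Hypothesis N_n : N%:R <= eta * #|V|%:R.
Hypothesis d_N3 : 20%:R * N%:R ^+ 3 <= eta ^+ 2 * d%:R.
Hypothesis dN_eta : 4%:R * L <= eta ^+ 2 / 8%:R * (d%:R / N%:R).
Hypothesis b_large : K * L <= b%:R.
Hypothesis dN_large : K * L <= d%:R / N%:R.
Hypothesis lam_d_L : K * (4%:R * L) * N%:R ^+ 2 <= lam * d%:R.
Hypothesis lam_d_kap : K * (1000 * b)%:R * N%:R ^+ 2 <= lam * d%:R.
Hypothesis d_large : (100 * 500 * (N * b) <= d)%N.

Lemma long_cycle :
  exists2 c, ucycle E c & (1 - 11%:R * eta) * #|V|%:R <= (size c)%:R.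
Proof.
have /card_gt0P[v0 _] : (0 < #|V|)%N by apply: leq_trans n_ge4.
have N_gt0 : (0 < N)%N by [].
have kN : (k <= N)%N by rewrite /N leqW // leq_addr.
have eta_gt0 : 0 < eta by case/andP: eta01.
have eta_le : eta <= 20%:R^-1 by case/andP: eta01.
have eta1 : 0 < eta <= 1 by rewrite eta_gt0; move: eta_le; lra.
have eta_half : eta <= 2%:R^-1 by move: eta_le; lra.
have NR : 0 < N%:R :> R by rewrite ltr0n.
have N_le_n : (N <= #|V|)%N.
  rewrite -(ler_nat R); apply: le_trans N_n _.
  by rewrite ler_piMl //; case/andP: eta1.
have inner_in (t : 'I_N) : inner k t -> (0 < t)%N /\ (t.+1 < N)%N.
  by move=> /andP[t0 tk]; split=> //; apply: leq_trans tk kN.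
have [f [high low spread goodf]] := @good_labelling R V E lam E_sym E_irr expE lam02
  N d Delta b N_gt0 d_gt0 min_deg max_deg K L eta KE n_ge4 N_le_n n_expL eta1 eta_half
  dN_eta b_large dN_large lam_d_L (1000 * b)%N lam_d_kap (inner k) inner_in.
have [P [gP uP PL szP]] := @path_forest R V E E_sym N d Delta k N_gt0 d_gt0 min_deg
  max_deg eta eta01 Delta_d k_gt1 kN k_N N_n d_N3 f high low spread.
pose lab (v : V) : nat := f v.
have n0 : 0 < #|V|%:R :> R by rewrite ltr0n; apply: leq_trans n_ge4.
have P0 : P != [::].
  apply: contraTneq szP => ->; rewrite -ltNge mulr_gt0 //.
  by move: eta_le; lra.
have size_n : (size (flatten P) <= #|V|)%N.
  by have := max_card [in flatten P]; rewrite (card_uniqP uP).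
have sizeP_n : (size P <= #|V|)%N.
  apply: leq_trans size_n; move: gP; clear; elim: P => //= p P IH /andP[gp /IH].
  by rewrite size_cat; case: p gp => //= x p _; clear; lia.
have few : (C.-1 ^ s * (size P).-1 < C ^ s)%N.
  apply: rounds_suffice s_large _; first exact: leq_trans C_large.
  apply: lt_le_trans n_expL; rewrite ltr_nat; apply: leq_trans sizeP_n.
  by case: (P) P0.
have Delta2 : (Delta <= 2 * d)%N.
  rewrite -(ler_nat R) natrM; apply: le_trans Delta_d _.
  by rewrite ler_wpM2r //; move: eta_le; lra.
have maxd v : (#|nbhd E v| <= 2 * d)%N by apply: leq_trans (max_deg v) Delta2.
have deg_class v t : (t < N)%N -> (N * #|nbhd E v :&: layer lab t| <= 4 * d)%N.
  move=> tN; rewrite -[t]/(nat_of_ord (Ordinal tN)) layer_class -(ler_nat R) !natrM.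
  have h1 : (1 + eta) * (N%:R^-1 * Delta%:R) <= N%:R^-1 * (4%:R * d%:R).
    rewrite mulrCA ler_wpM2l ?invr_ge0 ?(ltW NR) //.
    have h2 : Delta%:R <= 2%:R * d%:R :> R by rewrite -natrM ler_nat.
    have h3 : 1 + eta <= 2%:R by move: eta_le; lra.
    apply: le_trans (ler_pM _ _ h3 h2) _ => //; first by move: eta_gt0; lra.
    by rewrite mulrA (_ : 2%:R * 2%:R = 4%:R) -?natrM.
  rewrite -(ler_pdivlMl _ _ NR).
  exact: le_trans (ltW (high v _)) h1.
have degD v : (N * #|nbhd E v :&: (layer lab 0 :|: layer lab k.-1)| <= 8 * d)%N.
  rewrite setIUr; apply: leq_trans (leq_mul (leqnn N) (card_setU_le _ _)) _.
  have k1N : (k.-1 < N)%N by apply: leq_trans kN; rewrite prednK // ltnW.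
  rewrite mulnDr -[8%N]/(4 + 4)%N mulnDl.
  exact: leq_add (deg_class v 0 N_gt0) (deg_class v _ k1N).
pose Res (j : nat) := layer lab (k + j).
have jN j : (j <= s)%N -> (k + j < N)%N by move=> js; rewrite /N ltnS leq_add2l.
have useR j : (j <= s)%N -> usable E d N b (1000 * b) (Res j).
  move=> js; split; last by move=> v; apply: deg_class; apply: jN.
  by rewrite /Res -[(k + j)%N]/(nat_of_ord (Ordinal (jN j js))) layer_class.
have disR i j : (i < j)%N -> (j <= s)%N -> [disjoint Res i & Res j].
  move=> ij _; rewrite -setI_eq0; apply/eqP/setP=> v; rewrite !inE.
  by apply/negP=> /andP[/eqP-> /eqP] /addnI eij; rewrite eij ltnn in ij.
have disL j : (j <= s)%N -> [disjoint [set v | (lab v < k)%N] & Res j].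
  move=> _; rewrite -setI_eq0; apply/eqP/setP=> v; rewrite !inE.
  by apply/negP=> /andP[h /eqP e]; have := leq_addr j k; rewrite -e leqNgt h.
have [c uc cP] := link_cycle v0 E_sym b_gt0 N_gt0 d_large (leqnn _) min_deg maxd degD
  C_large useR disR disL gP uP P0 PL few.
by exists c => //; apply: le_trans szP _; rewrite ler_nat.
Qed.

End LongCycle.

(** * Choice of the parameters *)

(* Imported only here: the operations on arbitrary sets take over the names of
   those on finite sets. *)
From mathcomp Require Import all_classical all_reals all_analysis.
Import numFieldNormedType.Exports.

Lemma min_degree_le (V : finType) (E : rel V) v : (min_degree E <= degree E v)%N.
Proof.
rewrite /min_degree; have : v \in index_enum V by rewrite mem_index_enum.
elim: (index_enum V) => // u s IH; rewrite inE big_cons geq_min.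
by case/predU1P => [->|/IH ->]; rewrite ?leqnn ?orbT.
Qed.

(** Hides a large numeral, which is never to be computed in unary. *)
Lemma some_bound (m : nat) : exists C, (m <= C)%N.
Proof. by exists m. Qed.

Lemma K_large (R : realType) (K : R) : K = 8%:R ^+ 5 ->
  [/\ 1 <= K, 1000%:R <= K & 100%:R * 500%:R <= K ^+ 2].
Proof. by move=> ->; split; lra. Qed.

Lemma expander_min (R : realType) (V : finType) (E : rel V) (lam mu : R) :
  mu <= lam -> expander E lam -> expander E mu.
Proof. by move=> h expE U /expE; apply: le_trans; rewrite ler_wpM2r. Qed.

Section Scales.
Variables (R : realType) (C : nat) (K eta : R).
Hypothesis K_ge1 : 1 <= K.
Hypothesis eta01 : 0 < eta <= 1.

(* The number of labels is at most A times the logarithm of n. *)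
Let A : R := (C%:R + 2%:R) / eta + C%:R + 4%:R.

(** A sum of nonnegative terms, each of which serves one of the requirements
    in [scales]. *)
Definition needed : R :=
  20%:R * A ^+ 3 / eta ^+ 2 + 32%:R * A / eta ^+ 2 + 2%:R * K ^+ 3 * A ^+ 2
  + 2%:R * K ^+ 3 * A + 4%:R * K * A ^+ 2 + K * A.

Lemma needed_gt0 : 0 < needed.
Proof.
have e0 : 0 < eta by case/andP: eta01.
have K0 : 0 < K by apply: lt_le_trans K_ge1.
have A0 : 0 < A by rewrite /A ltr_wpDl // addr_ge0 ?divr_ge0 ?addr_ge0 ?(ltW e0).
rewrite /needed ltr_wpDl ?mulr_gt0 // !addr_ge0 ?divr_ge0 ?mulr_ge0 ?exprn_ge0 ?(ltW e0) ?(ltW K0) ?(ltW A0) //.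
Qed.

(** The numbers [k], [s] and [b] are of order [L], and so is [N]; every requirement
    then follows from the growth conditions, because it bounds a polynomial of degree
    at most 3 in [L]. *)
Lemma scales (L D lamD : R) : 1 <= L -> needed * L ^+ 3 <= D -> needed * L ^+ 3 <= lamD ->
  exists k s b : nat, let N : R := (k + s).+1%:R in
  [/\ (1 < k)%N, (0 < b)%N, (1 - eta) * N <= k%:R, C%:R * L <= s%:R & K * L <= b%:R] /\
  [/\ 20%:R * N ^+ 3 <= eta ^+ 2 * D,
      4%:R * L <= eta ^+ 2 / 8%:R * (D / N),
      K * L <= D / N,
      K * (4%:R * L) * N ^+ 2 <= lamD &
      K * (K * b%:R) * N ^+ 2 <= lamD /\
      K ^+ 2 * (N * b%:R) <= D].
Proof.
have eta0 : 0 < eta by case/andP: eta01.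
have K0 : 0 <= K by apply: le_trans K_ge1.
have A0 : 0 <= A by rewrite /A !addr_ge0 ?divr_ge0 ?addr_ge0 ?(ltW eta0).
move=> L1 hD hlam; have L0 : 0 <= L by apply: le_trans L1.
pose s := (Num.truncn (C%:R * L)).+1.
pose k := (Num.truncn (s.+1%:R / eta)).+2.
pose b := (Num.truncn (K * L)).+1.
have sC : C%:R * L <= s%:R by apply/ltW/truncnS_gt.
have s_le : s%:R <= C%:R * L + 1.
  by rewrite /s -natr1 lerD2r truncn_le mulr_ge0.
have kS : s.+1%:R / eta <= k%:R.
  by apply/ltW/(lt_le_trans (truncnS_gt _)); rewrite ler_nat.
have k_le : k%:R <= s.+1%:R / eta + 2%:R.
  by rewrite /k -addn2 natrD lerD2r truncn_le divr_ge0 ?(ltW eta0).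
have bK : K * L <= b%:R by apply/ltW/truncnS_gt.
have b_le : b%:R <= 2%:R * K * L.
  apply: (@le_trans _ _ (K * L + 1)).
    by rewrite /b -natr1 lerD2r truncn_le mulr_ge0.
  have : 1 <= K * L by apply: mulr_ege1.
  by lra.
exists k, s, b => N; have N1 : 1 <= N by rewrite ler1n.
have N0 : 0 < N by apply: lt_le_trans N1.
have N_le : N <= A * L.
  have h1 : s.+1%:R <= (C%:R + 2%:R) * L by rewrite -natr1; move: s_le L1; lra.
  have h2 : s.+1%:R / eta <= (C%:R + 2%:R) / eta * L.
    by rewrite [leRHS]mulrAC ler_wpM2r // invr_ge0 ltW.
  rewrite /N -addnS natrD /A.
  have : k%:R + s.+1%:R <= (C%:R + 2%:R) / eta * L + 2%:R + (C%:R + 2%:R) * L.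
    by rewrite lerD //; apply: le_trans k_le _; rewrite lerD2r.
  by move: L1; move: (_ / eta) => z; lra.
have AL0 : 0 <= A * L by rewrite mulr_ge0.
have N2 : N ^+ 2 <= A ^+ 2 * L ^+ 2 by rewrite -exprMn lerXn2r ?nnegrE ?(ltW N0).
have N3 : N ^+ 3 <= A ^+ 3 * L ^+ 3 by rewrite -exprMn lerXn2r ?nnegrE ?(ltW N0).
have L23 : L ^+ 2 <= L ^+ 3 by rewrite ler_weXn2l.
have L30 : 0 <= L ^+ 3 by rewrite exprn_ge0.
have e20 : 0 < eta ^+ 2 by rewrite exprn_gt0.
have T1 : 0 <= 20%:R * A ^+ 3 / eta ^+ 2 by rewrite divr_ge0 ?mulr_ge0 ?exprn_ge0 // ltW.
have T2 : 0 <= 32%:R * A / eta ^+ 2 by rewrite divr_ge0 ?mulr_ge0 // ltW.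
have T3 : 0 <= 2%:R * K ^+ 3 * A ^+ 2 by rewrite !mulr_ge0 ?exprn_ge0.
have T4 : 0 <= 2%:R * K ^+ 3 * A by rewrite !mulr_ge0.
have T5 : 0 <= 4%:R * K * A ^+ 2 by rewrite !mulr_ge0 ?exprn_ge0.
have T6 : 0 <= K * A by rewrite mulr_ge0.
have fromD t : t <= needed -> t * L ^+ 3 <= D.
  by move=> h; apply: le_trans hD; rewrite ler_wpM2r.
have fromlam t : t <= needed -> t * L ^+ 3 <= lamD.
  by move=> h; apply: le_trans hlam; rewrite ler_wpM2r.
have [n1 n2 n3] : [/\ 20%:R * A ^+ 3 / eta ^+ 2 <= needed, 32%:R * A / eta ^+ 2 <= needed
    & 2%:R * K ^+ 3 * A ^+ 2 <= needed].
  rewrite /needed; move: T1 T2 T3 T4 T5 T6; set t1 := _ / _; set t2 := _ / _.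
  set t3 := _ * A ^+ 2; set t4 := _ * K ^+ 3 * A; set t5 := _ * A ^+ 2; set t6 := K * A.
  by clearbody t1 t2 t3 t4 t5 t6 => ? ? ? ? ? ?; split; lra.
have [n4 n5 n6] : [/\ 2%:R * K ^+ 3 * A <= needed, 4%:R * K * A ^+ 2 <= needed
    & K * A <= needed].
  rewrite /needed; move: T1 T2 T3 T4 T5 T6; set t1 := _ / _; set t2 := _ / _.
  set t3 := _ * A ^+ 2; set t4 := _ * K ^+ 3 * A; set t5 := _ * A ^+ 2; set t6 := K * A.
  by clearbody t1 t2 t3 t4 t5 t6 => ? ? ? ? ? ?; split; lra.
have NAL := N_le.
split; split=> //.
- rewrite /N -addnS natrD; have : s.+1%:R <= eta * k%:R.
    by rewrite mulrC -ler_pdivrMr.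
  have : 0 <= eta * s.+1%:R by rewrite mulr_ge0 // ltW.
  by lra.
- have := fromD _ n1; rewrite mulrAC ler_pdivrMr // [D * _]mulrC.
  by move=> h; apply: le_trans h; rewrite -mulrA ler_wpM2l.
- rewrite mulrA ler_pdivlMr //.
  have h : 4%:R * L * N <= 4%:R * (A * L ^+ 3).
    rewrite -mulrA ler_wpM2l //; apply: (@le_trans _ _ (L * (A * L))).
      by rewrite ler_wpM2l.
    by rewrite mulrCA -expr2 ler_wpM2l.
  have := fromD _ n2; rewrite mulrAC ler_pdivrMr // => h2.
  have -> : eta ^+ 2 / 8%:R * D = D * eta ^+ 2 / 8%:R by rewrite mulrAC [_ * D]mulrC.
  rewrite ler_pdivlMr //; apply: le_trans h2.
  by move: h; lra.
- rewrite ler_pdivlMr //; apply: le_trans (fromD _ n6).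
  rewrite -!mulrA ler_wpM2l //; apply: (@le_trans _ _ (L * (A * L))).
    by rewrite ler_wpM2l.
  by rewrite mulrCA -expr2 ler_wpM2l.
- apply: le_trans (fromlam _ n5).
  have -> : 4%:R * K * A ^+ 2 * L ^+ 3 = K * (4%:R * L) * (A ^+ 2 * L ^+ 2) by ring.
  by rewrite ler_wpM2l // !mulr_ge0.
split.
- apply: le_trans (fromlam _ n3).
  have -> : 2%:R * K ^+ 3 * A ^+ 2 * L ^+ 3 =
    K * (K * (2%:R * K * L)) * (A ^+ 2 * L ^+ 2) by ring.
  apply: ler_pM => //; first by rewrite !mulr_ge0.
    by rewrite exprn_ge0 // ltW.
  by rewrite ler_wpM2l // ler_wpM2l.
- apply: le_trans (fromD _ n4).
  apply: (@le_trans _ _ (K ^+ 2 * ((A * L) * (2%:R * K * L)))).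
    rewrite ler_wpM2l ?exprn_ge0 //.
    exact: (ler_pM (ltW N0) (ler0n _ _) N_le b_le).
  have -> : K ^+ 2 * (A * L * (2%:R * K * L)) =
    2%:R * K ^+ 3 * A * L ^+ 2 by ring.
  by rewrite ler_wpM2l.
Qed.

End Scales.

Local Open Scope classical_set_scope.
Local Open Scope ring_scope.

Theorem theorem1p9 (R : realType) (w1 w2 eps : nat -> R)
  (hw1 : w1 n @[n --> \oo] --> +oo) (hw2 : w2 n @[n --> \oo] --> +oo)
  (heps : eps n @[n --> \oo] --> (0 : R)) (delta : R) (hdelta : 0 < delta) :
  exists N : nat, forall (n : nat) (V : finType) (E : rel V) (lambda : R)
      (d : nat),
    (N <= n)%N -> #|V| = n -> simple_graph E ->
    expander E lambda ->
    min_degree E = d ->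
    (max_degree E)%:R <= (1 + eps n) * d%:R ->
    w1 n * ln n%:R ^+ 3 <= lambda * d%:R ->
    w2 n * (ln n%:R ^+ 3 * ln (ln n%:R)) <= d%:R ->
    exists c : seq V, graph_cycle E c /\ (1 - delta) * n%:R <= (size c)%:R.
Proof.
have [C C_large] := some_bound (4 + 8 * (100 * 800)).
have [K KE] : exists K : R, K = 8%:R ^+ 5 by exists (8%:R ^+ 5).
have [K_ge1 K1000 K2] := K_large KE.
(* Eleven eta bounds the fraction of lost vertices. *)
pose eta := Num.min (delta / 11%:R) (20%:R^-1).
have eta_gt0 : 0 < eta by rewrite lt_min divr_gt0 // invr_gt0 ltr0n.
have eta20 : 0 < eta <= 20%:R^-1 by rewrite eta_gt0 ge_min lexx orbT.
have eta_delta : 11%:R * eta <= delta.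
  by rewrite mulrC -ler_pdivlMr // ge_min lexx.
have eta1 : 0 < eta <= 1.
  by rewrite eta_gt0; case/andP: eta20 => _; lra.
pose B := needed C K eta.
have [N1 _ hN1] : \forall n \near \oo, B <= w1 n by move/cvgryPge: hw1; apply.
have [N2 _ hN2] : \forall n \near \oo, B <= w2 n by move/cvgryPge: hw2; apply.
have [N3 _ hN3] : \forall n \near \oo, `|0 - eps n| < eta.
  by move/cvgrPdist_lt: heps; apply.
(* From here on ln (ln n) is at least 1. *)
pose N4 := (Num.truncn (expR (expR 1) : R)).+1.
exists (maxn (maxn N1 N2) (maxn N3 (maxn N4 7))).
move=> n V E lam d; rewrite !geq_max => /andP[/andP[n1 n2] /and3P[n3 n4 n7]] cV.
move=> [E_sym E_irr] expE min_d max_d hlam hd.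
pose L : R := ln n%:R.
have n_gt0 : 0 < n%:R :> R by rewrite ltr0n; apply: leq_trans n7.
have eL : expR L = n%:R by rewrite /L lnK // posrE.
have n_big : expR (expR 1) <= n%:R :> R.
  by apply: ltW; apply: lt_le_trans (truncnS_gt _) _; rewrite ler_nat.
have L_e : expR 1 <= L by rewrite -ler_expR eL.
have L1 : 1 <= L.
  by apply: le_trans L_e; apply: le_trans (expR_ge1Dx 1); rewrite lerDl.
have L0 : 0 < L by apply: lt_le_trans L1.
have lnL : 1 <= ln L by rewrite -[1]expRK ler_ln ?posrE ?expR_gt0.
have L3 : 0 <= L ^+ 3 by rewrite exprn_ge0 // ltW.
have B0 : 0 < B by apply: needed_gt0.
have dL : B * L ^+ 3 <= d%:R.
  apply: le_trans hd; rewrite -/L.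
  apply: (@le_trans _ _ (w2 n * L ^+ 3)); first by rewrite ler_wpM2r //; apply: hN2.
  rewrite ler_wpM2l ?ler_peMr //; apply: le_trans (ltW B0) _; exact: hN2.
(* Bounded expansion suffices, since d satisfies the same growth condition as
   lam * d. *)
pose mu := Num.min lam 2%:R.
have muL : B * L ^+ 3 <= mu * d%:R.
  have h1 : B * L ^+ 3 <= lam * d%:R.
    by apply: le_trans hlam; rewrite ler_wpM2r //; apply: hN1.
  rewrite /mu minEle; case: ifP => // _; apply: le_trans dL _.
  by rewrite ler_peMl // ler1n.
have [k [s [b [[k1 b0 kN sC bK] [N3d N_eta N_K N_lam [N_kap N_d]]]]]] :=
  scales K_ge1 eta1 L1 dL muL.
have d0 : 0 < d%:R :> R by apply: lt_le_trans dL; rewrite mulr_gt0 ?exprn_gt0.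
have mu02 : 0 <= mu <= 2%:R.
  rewrite ge_min lexx orbT andbT -(pmulr_lge0 _ d0).
  by apply: le_trans muL; rewrite mulr_ge0 // ltW.
have expmu : expander E mu by apply: expander_min expE; rewrite ge_min lexx.
have mind v : (d <= #|nbhd E v|)%N by rewrite -min_d; apply: min_degree_le.
have maxd v : (#|nbhd E v| <= max_degree E)%N by apply: (leq_bigmax (F := degree E)).
have d_gt0 : (0 < d)%N by rewrite -(ltr_nat R).
have /card_gt0P[v0 _] : (0 < #|V|)%N by rewrite cV; apply: leq_trans n7.
have d_n : d%:R <= n%:R :> R.
  by rewrite ler_nat -cV; apply: leq_trans (mind v0) (max_card _).
have Delta_d : (max_degree E)%:R <= (1 + eta) * d%:R.
  apply: le_trans max_d _; rewrite ler_wpM2r ?(ltW d0) // lerD2l.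
  apply: le_trans (ler_norm _) _; apply: ltW.
  by have := hN3 _ n3; rewrite sub0r normrN.
have N_n : (k + s).+1%:R <= eta * #|V|%:R.
  rewrite cV; set N := (k + s).+1%:R in N3d *.
  have N_ge1 : 1 <= N by rewrite ler1n.
  have N_cube : N <= N ^+ 3 by rewrite -[leLHS]expr1 ler_weXn2l.
  have h : eta ^+ 2 * d%:R <= eta * n%:R.
    rewrite expr2 -mulrA ler_wpM2l ?(ltW eta_gt0) //.
    by apply: le_trans d_n; rewrite ler_piMl ?(ltW d0) //; case/andP: eta1.
  apply: le_trans N_cube _; apply: le_trans h; apply: le_trans N3d.
  by rewrite ler_peMl ?exprn_ge0 ?ler1n // (le_trans _ N_ge1).
have N_kap' : K * (1000 * b)%:R * (k + s).+1%:R ^+ 2 <= mu * d%:R.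
  apply: le_trans N_kap; rewrite ler_wpM2r ?exprn_ge0 // ler_wpM2l ?(le_trans _ K_ge1) //.
  by rewrite natrM ler_wpM2r.
have N_d' : (100 * 500 * ((k + s).+1 * b) <= d)%N.
  rewrite -(ler_nat R) !natrM; apply: le_trans N_d.
  by rewrite ler_wpM2r // mulr_ge0.
have n_ge4 : (4 <= #|V|)%N by rewrite cV; apply: leq_trans n7.
have n_expL : #|V|%:R <= expR L by rewrite cV eL.
have [c uc szc] := @long_cycle R V E mu E_sym E_irr expmu mu02 k s d (max_degree E) b C
  C_large d_gt0 b0 k1 mind maxd K L eta KE n_ge4 n_expL eta20 Delta_d kN sC N_n N3d N_eta
  bK N_K N_lam N_kap' N_d'.
rewrite cV in szc; exists c; split; last first.
  by apply: le_trans szc; rewrite ler_wpM2r // lerD2l lerN2.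
split=> //; rewrite -(ltr_nat R); apply: lt_le_trans szc.
have n_ge7 : 7%:R <= n%:R :> R by rewrite ler_nat.
have eta_le : eta <= 20%:R^-1 by case/andP: eta20.
have h : 9%:R / 20%:R <= 1 - 11%:R * eta by move: eta_le; clear; lra.
apply: lt_le_trans (_ : 9%:R / 20%:R * 7%:R <= _); first by clear; lra.
by apply: ler_pM => //; rewrite divr_ge0.
Qed.
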